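(* There is an $\left(O\!\left(\frac{\sqrt d}{\varepsilon}\cdot\mathrm{polylog}(d/(\delta\beta))\right),\beta\right)$-accurate $(\varepsilon,\delta)$-DP algorithm for bucketized vector summation in the shuffle model. The encoder and the decoder run in time $\mathrm{poly}(nd/\beta,\log(|Y|/(\varepsilon\delta)))$.
   Context: Bucketized vector summation: $n$ users, user $i$ holds a bucket $y_i\in Y$ and a vector $x_i\in\mathbb{B}^d$ (closed unit ball of $\mathbb{R}^d$); the vector sum of bucket $y$ is $v_y=\sum_{i:y_i=y}x_i$; an estimate $\tilde v_y$ is $\eta$-accurate if $\|v_y-\tilde v_y\|<\eta$. $(\eta,\beta)$-accurate $(\varepsilon,\delta)$-DP algorithm: the encoder is $(\varepsilon,\delta)$-DP in the model, and for each $y\in Y$ the decoder's estimate is $\eta$-accurate with probability at least $1-\beta$. One-round shuffle model: each user applies an encoder producing messages; a shuffler outputs a uniformly random permutation of all messages; $(\varepsilon,\delta)$-DP means the distribution of shuffled messages is $(\varepsilon,\delta)$-DP as a function of the input sequence. Users and analyzer have shared public randomness. $0<\varepsilon\le O(1)$. *)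

(* Defs.v *)
From mathcomp Require Import all_boot all_order all_algebra all_fingroup.
From mathcomp Require Import reals sequences exp.

Set Implicit Arguments.
Unset Strict Implicit.
Unset Printing Implicit Defensive.

Import Order.TTheory GRing.Theory Num.Theory.
Local Open Scope ring_scope.

(** * Model of computation

    A randomized real RAM: natural-number and real registers, natural-number
    and real arrays with indirect addressing, exact unit-cost field operations
    and comparisons on reals (no floor, no root or logarithm), and fair coins.
    On natural numbers only addition and truncated subtraction are available,
    so bit lengths grow by O(1) per step.  Programs contain no real constants:
    one finite program serves all values of the parameters. *)

Inductive iexp : Type :=
| ICst of nat
| IReg of nat
| ILoad of iexp
| IAdd of iexp & iexp
| ISub of iexp & iexp.

Inductive rexp : Type :=
| RReg of nat
| RLoad of iexp
| ROfNat of iexp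
| RAdd of rexp & rexp
| ROpp of rexp
| RMul of rexp & rexp
| RInv of rexp.

Inductive bexp : Type :=
| BLei of iexp & iexp
| BLer of rexp & rexp
| BNot of bexp
| BAnd of bexp & bexp.

Inductive cmd : Type :=
| CSkip
| CISet of nat & iexp
| CRSet of nat & rexp
| CIStore of iexp & iexp          (* address, value *)
| CRStore of iexp & rexp          (* address, value *)
| CFlip of nat                    (* private coin into a nat register *)
| CFlipPub of nat                 (* public coin into a nat register *)
| CSend of iexp                   (* emit one message *)
| CSeq of cmd & cmd
| CIf of bexp & cmd & cmd
| CWhile of bexp & cmd.

(* Messages are natural numbers (equivalently, bit strings). *)
Record state (R : realType) : Type := State {
  ireg : nat -> nat;
  rreg : nat -> R;
  iarr : nat -> nat;
  rarr : nat -> R;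
  priv : seq bool;   (* unread private coins *)
  pub : seq bool;    (* unread public coins *)
  sent : seq nat
}.

Definition upd (A : Type) (f : nat -> A) (i : nat) (v : A) : nat -> A :=
  fun j => if j == i then v else f j.

Definition set_ireg (R : realType) (s : state R) (i v : nat) : state R :=
  State (upd (ireg s) i v) (rreg s) (iarr s) (rarr s) (priv s) (pub s) (sent s).

Definition set_rreg (R : realType) (s : state R) (i : nat) (v : R) : state R :=
  State (ireg s) (upd (rreg s) i v) (iarr s) (rarr s) (priv s) (pub s) (sent s).

Definition set_iarr (R : realType) (s : state R) (i v : nat) : state R :=
  State (ireg s) (rreg s) (upd (iarr s) i v) (rarr s) (priv s) (pub s) (sent s).

Definition set_rarr (R : realType) (s : state R) (i : nat) (v : R) : state R :=
  State (ireg s) (rreg s) (iarr s) (upd (rarr s) i v) (priv s) (pub s) (sent s).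

Definition flip_priv (R : realType) (s : state R) (i : nat) : state R :=
  State (upd (ireg s) i (nat_of_bool (head false (priv s))))
    (rreg s) (iarr s) (rarr s) (behead (priv s)) (pub s) (sent s).

Definition flip_pub (R : realType) (s : state R) (i : nat) : state R :=
  State (upd (ireg s) i (nat_of_bool (head false (pub s))))
    (rreg s) (iarr s) (rarr s) (priv s) (behead (pub s)) (sent s).

Definition send (R : realType) (s : state R) (m : nat) : state R :=
  State (ireg s) (rreg s) (iarr s) (rarr s) (priv s) (pub s) (rcons (sent s) m).

Fixpoint ieval (R : realType) (s : state R) (e : iexp) : nat :=
  match e with
  | ICst c => c
  | IReg i => ireg s i
  | ILoad a => iarr s (ieval s a)
  | IAdd a b => (ieval s a + ieval s b)%N
  | ISub a b => (ieval s a - ieval s b)%N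
  end.

Fixpoint reval (R : realType) (s : state R) (e : rexp) : R :=
  match e with
  | RReg i => rreg s i
  | RLoad a => rarr s (ieval s a)
  | ROfNat a => (ieval s a)%:R
  | RAdd a b => reval s a + reval s b
  | ROpp a => - reval s a
  | RMul a b => reval s a * reval s b
  | RInv a => (reval s a)^-1
  end.

Fixpoint beval (R : realType) (s : state R) (e : bexp) : bool :=
  match e with
  | BLei a b => (ieval s a <= ieval s b)%N
  | BLer a b => reval s a <= reval s b
  | BNot a => ~~ beval s a
  | BAnd a b => beval s a && beval s b
  end.

(* A configuration is the stack of commands still to be executed together with
   the store.  One [step] costs one time unit; the work per step is bounded by
   a constant depending only on the program. *)
Definition config (R : realType) : Type := (seq cmd * state R)%type.

Definition step (R : realType) (K : config R) : config R :=
  let: (stack, s) := K in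
  match stack with
  | [::] => ([::], s)
  | c :: k =>
    match c with
    | CSkip => (k, s)
    | CISet i e => (k, set_ireg s i (ieval s e))
    | CRSet i e => (k, set_rreg s i (reval s e))
    | CIStore a e => (k, set_iarr s (ieval s a) (ieval s e))
    | CRStore a e => (k, set_rarr s (ieval s a) (reval s e))
    | CFlip i => (k, flip_priv s i)
    | CFlipPub i => (k, flip_pub s i)
    | CSend e => (k, send s (ieval s e))
    | CSeq c1 c2 => (c1 :: c2 :: k, s)
    | CIf b c1 c2 => ((if beval s b then c1 else c2) :: k, s)
    | CWhile b c1 => (if beval s b then c1 :: c :: k else k, s)
    end
  end.

Definition run (R : realType) (T : nat) (c : cmd) (s : state R) : config R :=
  iter T (@step R) ([:: c], s).

Definition halts_within (R : realType) (T : nat) (c : cmd) (s : state R) : Prop :=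
  (run T c s).1 = [::].

(** * Bucketized vector summation *)

(* The buckets Y are numbered by 'I_nbuckets, with nbuckets = |Y|. *)
Record params (R : realType) : Type := Params {
  nusers : nat;
  vdim : nat;
  nbuckets : nat;
  eps : R;
  delta : R;
  beta : R
}.

(* Euclidean norm; the library norm on row vectors is the sup norm. *)
Definition l2norm (R : realType) (d : nat) (x : 'rV[R]_d) : R :=
  Num.sqrt (\sum_(j < d) x ord0 j ^+ 2).

Definition user_input (R : realType) (P : params R) : Type :=
  ('I_(nbuckets P) * 'rV[R]_(vdim P))%type.

Definition valid_input (R : realType) (P : params R) (u : user_input P) : Prop :=
  l2norm u.2 <= 1.

Definition dataset (R : realType) (P : params R) : Type :=
  'I_(nusers P) -> user_input P.

Definition valid_dataset (R : realType) (P : params R) (X : dataset P) : Prop :=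
  forall i, valid_input (X i).

Definition neighbors (R : realType) (P : params R) (X X' : dataset P) : Prop :=
  exists i, forall j, j != i -> X j = X' j.

Definition bucket_sum (R : realType) (P : params R) (X : dataset P)
    (y : 'I_(nbuckets P)) : 'rV[R]_(vdim P) :=
  \sum_(i | (X i).1 == y) (X i).2.

(** * One-round shuffle protocols with public randomness *)

Definition param_regs (R : realType) (P : params R) : nat -> R :=
  nth 0 [:: eps P; delta P; beta P].

Definition row_cells (R : realType) (d : nat) (x : 'rV[R]_d) : nat -> R :=
  fun j => if insub j is Some j' then x ord0 j' else 0.

(* The encoder gets n, d, |Y|, y, eps, delta, beta in registers and x in the
   real array; it does not get the index of the user. *)
Definition enc_init (R : realType) (P : params R) (r c : seq bool)
    (u : user_input P) : state R :=
  State (nth 0%N [:: nusers P; vdim P; nbuckets P; nat_of_ord u.1])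
    (param_regs P) (fun=> 0%N) (row_cells u.2) c r [::].

(* The decoder gets n, d, |Y|, the queried bucket y, the number of messages,
   eps, delta, beta in registers and the messages in the nat array. *)
Definition dec_init (R : realType) (P : params R) (r c : seq bool)
    (y : 'I_(nbuckets P)) (ms : seq nat) : state R :=
  State (nth 0%N [:: nusers P; vdim P; nbuckets P; nat_of_ord y; size ms])
    (param_regs P) (nth 0%N ms) (fun=> 0) c r [::].

(* T is both the time bound and the number of public and of private coins
   supplied to each run: a run of at most T steps cannot read more. *)
Definition enc_output (R : realType) (P : params R) (T : nat) (enc : cmd)
    (r c : seq bool) (u : user_input P) : seq nat :=
  sent (run T enc (enc_init r c u)).2.

(* The estimate is read off the first d cells of the real array. *)
Definition dec_output (R : realType) (P : params R) (T : nat) (dec : cmd)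
    (r c : seq bool) (y : 'I_(nbuckets P)) (ms : seq nat) : 'rV[R]_(vdim P) :=
  \row_(j < vdim P) rarr (run T dec (dec_init r c y ms)).2 j.

Definition all_messages (R : realType) (P : params R) (T : nat) (enc : cmd)
    (r : T.-tuple bool) (X : dataset P)
    (c : {ffun 'I_(nusers P) -> T.-tuple bool}) : seq nat :=
  flatten [seq enc_output T enc r (c i) (X i) | i <- enum 'I_(nusers P)].

Definition unif_mean (R : realType) (A : finType) (f : A -> R) : R :=
  (\sum_(a : A) f a) / #|A|%:R.

(* Mean of f over a uniformly random permutation of the list ms. *)
Definition shuffle_mean (R : realType) (ms : seq nat) (f : seq nat -> R) : R :=
  unif_mean (fun s : {perm 'I_(size ms)} =>
    f [seq nth 0%N ms (s i) | i <- enum 'I_(size ms)]).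

(* Mean of f over the shuffler's output, for fixed public coins r. *)
Definition view_mean (R : realType) (P : params R) (T : nat) (enc : cmd)
    (r : T.-tuple bool) (X : dataset P) (f : seq nat -> R) : R :=
  unif_mean (fun c : {ffun 'I_(nusers P) -> T.-tuple bool} =>
    shuffle_mean (all_messages enc r X c) f).

(* Privacy is required for every outcome r of the public coins. *)
Definition shuffle_dp (R : realType) (P : params R) (T : nat) (enc : cmd) : Prop :=
  forall (r : T.-tuple bool) (X X' : dataset P),
    valid_dataset X -> valid_dataset X' -> neighbors X X' ->
  forall S : pred (seq nat),
    view_mean enc r X (fun ms => (S ms)%:R)
      <= expR (eps P) * view_mean enc r X' (fun ms => (S ms)%:R) + delta P.

Definition accuracy_prob (R : realType) (P : params R) (T : nat) (enc dec : cmd)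
    (eta : R) (X : dataset P) (y : 'I_(nbuckets P)) : R :=
  unif_mean (fun r : T.-tuple bool =>
    view_mean enc r X (fun ms =>
      unif_mean (fun c : T.-tuple bool =>
        ((l2norm (bucket_sum X y - dec_output T dec r c y ms) < eta)%R)%:R))).

Definition accurate (R : realType) (P : params R) (T : nat) (enc dec : cmd)
    (eta : R) : Prop :=
  forall X : dataset P, valid_dataset X -> forall y : 'I_(nbuckets P),
    1 - beta P <= accuracy_prob T enc dec eta X y.

Definition encoder_time (R : realType) (P : params R) (T : nat) (enc : cmd) : Prop :=
  forall (r c : T.-tuple bool) (u : user_input P), valid_input u ->
    halts_within T enc (enc_init r c u).

(* Time for one queried bucket, on every list the shuffler may output. *)
Definition decoder_time (R : realType) (P : params R) (T : nat) (enc dec : cmd) : Prop :=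
  forall (r e : T.-tuple bool) (X : dataset P)
    (c : {ffun 'I_(nusers P) -> T.-tuple bool}) (ms : seq nat)
    (y : 'I_(nbuckets P)),
  valid_dataset X -> perm_eq ms (all_messages enc r X c) ->
    halts_within T dec (dec_init r e y ms).

(** * Asymptotic bounds *)

(* 1 + log t, with negative logs cut off at 0, so that O(.) and poly(.) bounds also make sense for
   arguments near or below 1. *)
Definition plog (R : realType) (t : R) : R := 1 + Num.max 0 (ln t).

(* poly(a, b) means at most C * (a + b) ^ q for some constants C and q. *)
Definition time_bound (R : realType) (C : R) (q : nat) (P : params R) : R :=
  C * ((nusers P)%:R * (vdim P)%:R / beta P
       + plog ((nbuckets P)%:R / (eps P * delta P))) ^+ q.

Definition error_bound (R : realType) (C : R) (q : nat) (P : params R) : R :=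
  C * (Num.sqrt (vdim P)%:R / eps P
       * plog ((vdim P)%:R / (delta P * beta P)) ^+ q).

(* E is the constant in the standing assumption 0 < eps <= O(1). *)
Definition admissible (R : realType) (E : R) (P : params R) : Prop :=
  [/\ (0 < nusers P)%N, (0 < vdim P)%N & (0 < nbuckets P)%N] /\
  [/\ 0 < eps P <= E, 0 < delta P < 1 & 0 < beta P < 1].

(* Main.v *)
Require Import Defs.
From mathcomp Require Import all_boot all_order all_algebra all_fingroup.
From mathcomp Require Import reals sequences exp.
From mathcomp Require Import boolp ring lra zify.

(** Public coins define a random F_2-linear hash of the bucket into 2^k >= 2n/beta
    classes, so that with probability 1 - beta/2 no other occupied bucket meets the
    queried one.  The shuffler makes unary addition secure: every user sends, for
    each of the d 2^k pairs (class, coordinate), g + ceil(g v) copies of the name of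
    that pair, v being the coordinate of x in the class of y and 0 elsewhere, plus
    one more copy for each head among M fair coins.  The analyzer sees only the
    total counts, hence a vector shifted by independent Binomial(nM, 1/2) noise.
    Away from the tails a unit shift changes the binomial weights by a factor
    1 + O(s), where the noise has relative size s; a Chernoff bound on the
    likelihood ratio of the product distribution turns the l2 sensitivity O(g) into
    (1/e, delta/2)-privacy as soon as s is below 1/(g e log).  Here e is about
    1/eps, but at most 4/delta + 1: beyond that, 1/e <= delta/4 makes the protocol
    (0, delta)-private.  This cap keeps log(1/eps) out of the error. *)

Set Implicit Arguments.
Unset Strict Implicit.
Unset Printing Implicit Defensive.

Import Order.TTheory GRing.Theory Num.Theory.
Local Open Scope ring_scope.

(** * Privacy of product distributions *)

Section RealBounds.
Variable R : realType.
Implicit Types x v : R.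

(** Write l for about log2(d/(delta beta)) and N = nM. The multiplier is g = n + d: since g >= n,
    rounding by all n users costs at most 1 per coordinate of the estimate; since g >= d, rounding
    in the at most 2d cells that one user can alter adds only O(g^2) to the squared l2 sensitivity.
    The noise level is s = 1/(512 g e l), small enough for the likelihood-ratio moment of order 2 e
    l to stay bounded, and M is taken with s^2 N >= 40 l, so that deviations beyond sN/2 have
    probability at most 2 * 2^(-5l). The error per coordinate is then about sN/g, of order e l^2.

    Two obstacles shape the rest. The running time may depend on 1/eps only through its logarithm,
    while M grows like e^2; the case eps n <= 1 is therefore answered by the zero vector, and
    otherwise 1/eps < n. The machine has no floor, root or logarithm, so each derived parameter is
    the first value that passes a test, found by counting or doubling; the test gives the lower
    bounds that privacy needs, and minimality the upper bounds for error and time. *)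

Lemma expR_le_quad x : x <= 1 / 2 -> expR x <= 1 + x + 2 * x ^+ 2.
Proof.
move=> hx; have h1 : 0 < 1 - x by lra.
have hN := expR_ge1Dx (- x).
have -> : expR x = (expR (- x))^-1 by rewrite expRN invrK.
apply: (@le_trans _ _ (1 - x)^-1).
  by rewrite lef_pV2 ?posrE ?expR_gt0.
rewrite -[leLHS]mul1r ler_pdivrMr //.
have h2 : 0 <= x ^+ 2 * (1 - 2 * x) by rewrite mulr_ge0 ?sqr_ge0 //; lra.
rewrite -subr_ge0; suff -> : (1 + x + 2 * x ^+ 2) * (1 - x) - 1 = x ^+ 2 * (1 - 2 * x) by [].
by ring.
Qed.

Lemma exp1Dx_le_quad m v : 0 <= 1 + v -> m%:R * v <= 1 / 2 ->
  (1 + v) ^+ m <= 1 + m%:R * v + 2 * (m%:R * v) ^+ 2.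
Proof.
move=> h1 h2; apply: (le_trans _ (expR_le_quad h2)).
rewrite expRM_natl lerXn2r ?nnegrE ?expR_ge0 //.
exact: expR_ge1Dx.
Qed.

End RealBounds.

Section ProductDP.
Variables (R : realType) (J K : finType).

Lemma sum_ffun_prod (f : J -> K -> R) :
  (\sum_(w : {ffun J -> K}) \prod_j f j (w j)) = \prod_j \sum_k f j k.
Proof. by rewrite bigA_distr_bigA. Qed.

Lemma marginal_ffun_prod (f : J -> K -> R) (i : J) (A : pred K) :
  (forall j, \sum_k f j k = 1) ->
  \sum_(w : {ffun J -> K}) (\prod_j f j (w j)) * (A (w i))%:R =
  \sum_(k | A k) f i k.
Proof.
move=> f1.
pose h j k := f j k * (if j == i then (A k)%:R else 1).
transitivity (\sum_(w : {ffun J -> K}) \prod_j h j (w j)).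
  apply: eq_bigr => w _; rewrite /h big_split /=; congr (_ * _).
  by rewrite (bigD1 i) //= eqxx big1 ?mulr1 // => j /negPf ->.
rewrite sum_ffun_prod (bigD1 i) //= [X in _ * X]big1 ?mulr1.
  rewrite [RHS]big_mkcond; apply: eq_bigr => k _.
  by rewrite /h eqxx; case: (A k); rewrite ?mulr1 ?mulr0.
by move=> j /negPf ji; rewrite -[RHS](f1 j); apply: eq_bigr => k _; rewrite /h ji mulr1.
Qed.

Variables (f q : J -> K -> R) (good : J -> pred K) (u tau : J -> R).
Hypothesis f_ge0 : forall j k, 0 <= f j k.
Hypothesis q_ge0 : forall j k, 0 <= q j k.
Hypothesis f_sum1 : forall j, \sum_k f j k = 1.
Hypothesis q_sum1 : forall j, \sum_k q j k = 1.
Hypothesis u_ge0 : forall j, 0 <= u j.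
Hypothesis near : forall j k, good j k -> `|f j k - q j k| <= u j * q j k.
Hypothesis f_bad : forall j, \sum_(k | ~~ good j k) f j k <= tau j.
Hypothesis q_bad : forall j, \sum_(k | ~~ good j k) q j k <= tau j.

(** Expand (1 + v)^m with v = f/q - 1. The linear terms sum to m times the difference of the two
    masses of the good set, hence to at most m tau, because both distributions have total mass 1.
    Only the quadratic terms survive, and this is why l2 rather than l1 sensitivity matters. *)
Lemma good_moment m j : m%:R * u j <= 1 / 2 ->
  \sum_k (if good j k then q j k * (f j k / q j k) ^+ m else 0)
    <= expR (m%:R * tau j + 2 * (m%:R * u j) ^+ 2).
Proof.
move=> hm; apply: le_trans (expR_ge1Dx _).
rewrite -big_mkcond /=.
set c : R := 2 * (m%:R * u j) ^+ 2.
have c0 : 0 <= c by rewrite mulr_ge0 ?sqr_ge0.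
apply: (@le_trans _ _ (\sum_(k | good j k)
    (q j k + m%:R * (f j k - q j k) + c * q j k))).
  apply: ler_sum => k gk.
  have := near gk; have := q_ge0 j k; rewrite le_eqVlt => /orP[/eqP <-|q0 hn].
    rewrite !mulr0 normr_le0 subr0 => /eqP ->.
    by rewrite ?(mul0r, subrr, mulr0, addr0).
  set v := f j k / q j k - 1.
  have fE : f j k / q j k = 1 + v by rewrite /v; ring.
  have dE : f j k - q j k = q j k * v by rewrite /v; field; rewrite gt_eqF.
  have vu : `|v| <= u j.
    by move: hn; rewrite dE normrM (gtr0_norm q0) mulrC ler_pM2r.
  have v1 : 0 <= 1 + v by rewrite -fE divr_ge0.
  have m0 : (0 : R) <= m%:R by exact: ler0n.
  rewrite fE dE.
  have -> : q j k + m%:R * (q j k * v) + c * q j k = q j k * (1 + m%:R * v + c) by ring.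
  rewrite ler_pM2l //.
  have mv : m%:R * `|v| <= m%:R * u j by rewrite ler_wpM2l.
  apply: (le_trans (exp1Dx_le_quad v1 _)).
    by apply: le_trans hm; apply: le_trans mv; rewrite ler_wpM2l // ler_norm.
  rewrite lerD2l /c ler_pM2l // -(real_normK (num_real (m%:R * v))).
  by rewrite normrM (ger0_norm m0) lerXn2r ?nnegrE ?mulr_ge0.
rewrite !big_split /= -!mulr_sumr sumrB.
have gf : \sum_(k | good j k) f j k <= 1.
  by rewrite -(f_sum1 j) [leRHS](bigID (good j)) /= lerDl sumr_ge0.
have gq1 : \sum_(k | good j k) q j k <= 1.
  by rewrite -(q_sum1 j) [leRHS](bigID (good j)) /= lerDl sumr_ge0.
have gq : 1 - tau j <= \sum_(k | good j k) q j k.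
  by move: (q_sum1 j) (q_bad j); rewrite (bigID (good j)) /=; lra.
rewrite -addrA; apply: lerD => //; apply: lerD.
  by rewrite ler_wpM2l //; lra.
by rewrite -[leRHS]mulr1 ler_wpM2l.
Qed.

(* Chernoff bound on the privacy loss of a product distribution: on the good
   set the likelihood ratios have a sub-Gaussian m-th moment. *)
Lemma product_dp m (e0 : R) (F : {ffun J -> K} -> R) :
  (forall j, m.+1%:R * u j <= 1 / 2) ->
  (forall w, 0 <= F w <= 1) ->
  \sum_(w : {ffun J -> K}) (\prod_j f j (w j)) * F w <=
    expR e0 * (\sum_(w : {ffun J -> K}) (\prod_j q j (w j)) * F w) + \sum_j tau j
    + expR (- (m%:R * e0)
            + \sum_j (m.+1%:R * tau j + 2 * (m.+1%:R * u j) ^+ 2)).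
Proof.
move=> hm F01.
pose P (w : {ffun J -> K}) := \prod_j f j (w j).
pose Q (w : {ffun J -> K}) := \prod_j q j (w j).
pose h j k := if good j k then q j k * (f j k / q j k) ^+ m.+1 else 0.
pose H (w : {ffun J -> K}) := \prod_j h j (w j).
have P0 w : 0 <= P w by apply: prodr_ge0.
have Q0 w : 0 <= Q w by apply: prodr_ge0.
have h0 j k : 0 <= h j k.
  by rewrite /h; case: ifP => // _; rewrite mulr_ge0 ?exprn_ge0 ?divr_ge0.
have H0 w : 0 <= H w by apply: prodr_ge0.
(* Each outcome is paid for by one of three terms: the ratio P/Q is at most exp(e0), or some
   coordinate is bad, or the ratio is larger and Markov's inequality for its m-th power applies. *)
have pointwise w : P w * F w <= expR e0 * (Q w * F w)
    + \sum_j P w * (~~ good j (w j))%:R + expR (- (m%:R * e0)) * H w.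
  have [F0 F1] := andP (F01 w).
  have T1 : 0 <= expR e0 * (Q w * F w) by rewrite !mulr_ge0 ?expR_ge0.
  have T2 : 0 <= \sum_j P w * (~~ good j (w j))%:R.
    by apply: sumr_ge0 => j _; rewrite mulr_ge0.
  have T3 : 0 <= expR (- (m%:R * e0)) * H w by rewrite mulr_ge0 ?expR_ge0.
  have PF : P w * F w <= P w by rewrite -[leRHS]mulr1 ler_wpM2l.
  case: (boolP [forall j, good j (w j)]) => [/forallP allg|]; last first.
    rewrite negb_forall => /existsP[i gi].
    suff : P w <= \sum_j P w * (~~ good j (w j))%:R by lra.
    rewrite (bigD1 i) //= gi mulr1 lerDl; apply: sumr_ge0 => j _.
    by rewrite mulr_ge0.
  have [le|gt] := leP (P w) (expR e0 * Q w).
    suff : P w * F w <= expR e0 * (Q w * F w) by lra.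
    by rewrite mulrA ler_wpM2r.
  have Pgt0 : 0 < P w by apply: le_lt_trans gt; rewrite mulr_ge0 ?expR_ge0.
  have qn0 j : q j (w j) != 0.
    apply/eqP => qj0; have := near (allg j).
    rewrite qj0 mulr0 subr0 normr_le0 => /eqP fj0.
    by move: Pgt0; rewrite /P (bigD1 j) //= fj0 mul0r ltxx.
  have Qgt0 : 0 < Q w by apply: prodr_gt0 => j _; rewrite lt_neqAle eq_sym qn0 q_ge0.
  suff : P w <= expR (- (m%:R * e0)) * H w by lra.
  have -> : H w = Q w * (P w / Q w) ^+ m.+1.
    rewrite /H /P /Q -prodf_div -prodrXl -big_split /=.
    by apply: eq_bigr => j _; rewrite /h allg.
  (* The moment of order m + 1 under Q is the moment of order m under P; this explains the shift
     between m and [m.+1] in the bound. *)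
  have -> : Q w * (P w / Q w) ^+ m.+1 = P w * (P w / Q w) ^+ m.
    by rewrite exprS mulrA mulrCA divff ?gt_eqF // mulr1.
  rewrite mulrCA.
  rewrite -[leLHS]mulr1 ler_pM2l // expRN mulrC ler_pdivlMr ?expR_gt0 // mul1r.
  rewrite expRM_natl lerXn2r ?nnegrE ?expR_ge0 ?divr_ge0 //.
  by rewrite ler_pdivlMr // ltW.
apply: le_trans (ler_sum _ (fun w _ => pointwise w)) _.
rewrite big_split /= big_split /= -!mulr_sumr -addrA -[leRHS]addrA lerD2l; apply: lerD.
  rewrite exchange_big /=; apply: ler_sum => j _.
  by rewrite (@marginal_ffun_prod f j (fun k => ~~ good j k)).
rewrite expRD ler_pM2l ?expR_gt0 // /H sum_ffun_prod expR_sum.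
apply: ler_prod => j _; rewrite sumr_ge0 //=.
exact: good_moment.
Qed.

End ProductDP.

(** * Binomial weights *)

Section Binomial.
Variable R : realType.

Definition binw (M h : nat) : R := 'C(M, h)%:R / 2 ^+ M.

Lemma binw_ge0 M h : 0 <= binw M h.
Proof. by rewrite divr_ge0 ?exprn_ge0. Qed.

Lemma binw_small M h : (M < h)%N -> binw M h = 0.
Proof. by move=> hM; rewrite /binw bin_small // mul0r. Qed.

Lemma binw_pgf M (z : R) : \sum_(h < M.+1) binw M h * z ^+ h = ((1 + z) / 2) ^+ M.
Proof.
rewrite expr_div_n exprDn mulr_suml; apply: eq_bigr => h _.
by rewrite expr1n mul1r -mulr_natl /binw; ring.
Qed.

Lemma binw_sum M : \sum_(h < M.+1) binw M h = 1.
Proof.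
have := binw_pgf M 1; have -> : (1 + 1 : R) / 2 = 1 by lra.
rewrite expr1n => <-.
by apply: eq_bigr => h _; rewrite expr1n mulr1.
Qed.

(** After centring, each coin contributes cosh(s/2). The quadratic bounds on exp(s/2) and exp(-s/2)
    average to 1 + s^2/2, which is at most exp(s^2/2). *)
Lemma binw_mgf M (s : R) : `|s| <= 1 ->
  \sum_(h < M.+1) binw M h * expR (s * (h%:R - M%:R / 2)) <= expR (s ^+ 2 * M%:R / 2).
Proof.
rewrite ler_norml => /andP[s1 s2].
have -> : \sum_(h < M.+1) binw M h * expR (s * (h%:R - M%:R / 2)) =
    ((expR (s / 2) + expR (- (s / 2))) / 2) ^+ M.
  have -> : (expR (s / 2) + expR (- (s / 2))) / 2 = expR (- (s / 2)) * ((1 + expR s) / 2).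
    have -> : expR (s / 2) = expR (- (s / 2)) * expR s by rewrite -expRD; congr expR; lra.
    by ring.
  rewrite exprMn -binw_pgf mulr_sumr; apply: eq_bigr => h _.
  rewrite [RHS]mulrCA -!expRM_natl -expRD; congr (_ * expR _).
  by ring.
have -> : s ^+ 2 * M%:R / 2 = M%:R * (s ^+ 2 / 2) by ring.
rewrite expRM_natl lerXn2r ?nnegrE ?expR_ge0 ?divr_ge0 ?addr_ge0 ?expR_ge0 //.
apply: le_trans (expR_ge1Dx _).
have h1 : s / 2 <= 1 / 2 by lra.
have h2 : - (s / 2) <= 1 / 2 by lra.
have := expR_le_quad h1; have := expR_le_quad h2.
by rewrite !expr2; lra.
Qed.

(** Markov's inequality for the sum of the exponentials with tilts s and -s. The tilt equals the
    relative deviation, so the exponent is -s * sM + s^2 M / 2. *)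
Lemma binw_tail M (s : R) : 0 <= s <= 1 ->
  \sum_(h < M.+1 | s * M%:R < `|h%:R - M%:R / 2|) binw M h
    <= 2 * expR (- (s ^+ 2 * M%:R / 2)).
Proof.
move=> /andP[s0 s1].
pose E (t : R) (h : nat) := expR (t * (h%:R - M%:R / 2)).
have hE : \sum_(h < M.+1 | s * M%:R < `|h%:R - M%:R / 2|) binw M h <=
   expR (- (s ^+ 2 * M%:R)) * (\sum_(h < M.+1) binw M h * E s h
     + \sum_(h < M.+1) binw M h * E (- s) h).
  rewrite -big_split mulr_sumr /= big_mkcond; apply: ler_sum => h _.
  have E0 t : 0 <= E t h by exact: expR_ge0.
  case: ifP => [hh|_]; last first.
    by rewrite mulr_ge0 ?expR_ge0 // addr_ge0 // mulr_ge0 ?binw_ge0.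
  rewrite -mulrDr mulrCA -[leLHS]mulr1 ler_wpM2l ?binw_ge0 // mulrDr /E -!expRD.
  have hs : s * (s * M%:R) <= s * `|h%:R - M%:R / 2| by rewrite ler_wpM2l // ltW.
  case: (ger0P (h%:R - M%:R / 2)) hs => hx hs.
    rewrite -[leLHS]addr0; apply: lerD; last exact: expR_ge0.
    by rewrite -[leLHS]expR0 ler_expR expr2; lra.
  rewrite -[leLHS]add0r; apply: lerD; first exact: expR_ge0.
  by rewrite -[leLHS]expR0 ler_expR expr2; lra.
apply: (le_trans hE).
have m1 := @binw_mgf M s; have m2 := @binw_mgf M (- s).
rewrite normrN (ger0_norm s0) sqrrN in m1 m2.
have := m1 s1; have := m2 s1 => {}m1 {}m2.
apply: (@le_trans _ _ (expR (- (s ^+ 2 * M%:R)) * (2 * expR (s ^+ 2 * M%:R / 2)))).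
  by rewrite ler_wpM2l ?expR_ge0 // mulr_natl mulr2n; apply: lerD.
rewrite mulrCA -expRD ler_pM2l // ler_expR; lra.
Qed.

Section Ratio.
Variables (M : nat) (s : R).
Hypothesis M_gt0 : (0 < M)%N.
Hypothesis s_ge0 : 0 <= s.
Hypothesis s_small : s <= 1 / 8.
(** Twice the width sM of the good window: a count that is good for one centre must remain central
    for the centre of the neighbouring dataset. *)
Let central (k : nat) := `|k%:R - M%:R / 2| <= 2 * s * M%:R.

(** Consecutive weights have ratio (M - k)/(k + 1), which the central range keeps between (1/2 -
    2s)/(1/2 + 2s) and its inverse. The inverse is at most 1 + 16 s exactly because s <= 1/8. *)
Lemma binw_step k : central k -> central k.+1 ->
  binw M k.+1 <= expR (16 * s) * binw M k /\ binw M k <= expR (16 * s) * binw M k.+1.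
Proof.
rewrite /central -[k.+1%:R]natr1 !ler_norml => /andP[k1 k2] /andP[k3 k4].
have M0 : 0 < M%:R :> R by rewrite ltr0n.
have rho := expR_ge1Dx (16 * s).
have kM : (k <= M)%N.
  rewrite -(ler_nat R); have : s * M%:R <= 1 / 8 * M%:R by rewrite ler_wpM2r ?ler0n.
  lra.
have binE : binw M k.+1 * (k%:R + 1) = binw M k * (M%:R - k%:R).
  have : ('C(M, k.+1) * k.+1 = 'C(M, k) * (M - k))%N by rewrite mulnC mul_bin_left mulnC.
  move=> /(congr1 (fun x => x%:R : R)); rewrite !natrM natrB // -[k.+1%:R]natr1 /binw => e.
  by rewrite mulrAC e mulrAC.
have A0 : 0 < M%:R * (1 / 2 - 2 * s) by rewrite mulr_gt0 //; move: s_small; lra.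
have AB : M%:R * (1 / 2 + 2 * s) <= expR (16 * s) * (M%:R * (1 / 2 - 2 * s)).
  apply: (@le_trans _ _ ((1 + 16 * s) * (M%:R * (1 / 2 - 2 * s)))).
    rewrite mulrCA ler_pM2l //.
    have : 0 <= s * (1 / 8 - s) by rewrite mulr_ge0 // subr_ge0.
    lra.
  by rewrite ler_pM2r.
have b0 := binw_ge0 M k; have b1 := binw_ge0 M k.+1.
split; rewrite -(ler_pM2r A0).
  apply: (@le_trans _ _ (binw M k.+1 * (k%:R + 1))).
    by rewrite ler_wpM2l //; lra.
  rewrite binE [leRHS]mulrAC [leRHS]mulrC; apply: ler_wpM2l => //.
  by apply: le_trans AB; lra.
apply: (@le_trans _ _ (binw M k * (M%:R - k%:R))).
  by rewrite ler_wpM2l //; lra.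
rewrite -binE [leRHS]mulrAC [leRHS]mulrC; apply: ler_wpM2l => //.
by apply: le_trans AB; lra.
Qed.

Lemma binw_steps k i : central k -> central (k + i) ->
  binw M (k + i) <= expR (16 * s) ^+ i * binw M k /\
  binw M k <= expR (16 * s) ^+ i * binw M (k + i).
Proof.
elim: i => [|i IH] ck cki; first by rewrite addn0 !expr0 !mul1r.
have cki' : central (k + i).
  move: ck cki; rewrite /central addnS -[(k+i).+1%:R]natr1 natrD !ler_norml => /andP[? ?] /andP[? ?].
  have : (0 : R) <= i%:R by exact: ler0n.
  by move=> ?; apply/andP; split; lra.
rewrite addnS in cki *.
have [l1 l2] := IH ck cki'; have [l3 l4] := binw_step cki' cki.
have r0 : 0 <= expR (16 * s) by exact: expR_ge0.
split.
  by rewrite exprS -mulrA; apply: (le_trans l3); rewrite ler_wpM2l.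
rewrite exprSr -mulrA; apply: (le_trans l2).
by rewrite ler_wpM2l ?exprn_ge0.
Qed.

Lemma binw_near k k' : central k -> central k' ->
  16 * s * `|k%:R - k'%:R| <= 1 / 2 ->
  `|binw M k - binw M k'| <= 32 * s * `|k%:R - k'%:R| * binw M k'.
Proof.
move=> ck ck' hd.
pose i := (maxn k k' - minn k k')%N.
have iE : `|k%:R - k'%:R| = i%:R :> R.
  rewrite /i; case: (leqP k k') => hk; rewrite natrB ?(ltnW hk) //.
    by rewrite distrC ger0_norm // subr_ge0 ler_nat.
  by rewrite ger0_norm // subr_ge0 ler_nat ltnW.
set rho := expR (16 * s) ^+ i.
have [h1 h2] : binw M k <= rho * binw M k' /\ binw M k' <= rho * binw M k.
  rewrite /rho /i; case: (leqP k k') => hk.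
    by have := @binw_steps k (k' - k); rewrite subnKC // => /(_ ck ck')[].
  by have := @binw_steps k' (k - k'); rewrite subnKC ?(ltnW hk) // => /(_ ck' ck)[].
rewrite iE in hd *.
have rhoE : rho = expR (16 * s * i%:R) by rewrite /rho -expRM_natr.
have x0 : 0 <= 16 * s * i%:R by rewrite !mulr_ge0.
have rho1 : 1 <= rho by rewrite rhoE -[leLHS]expR0 ler_expR.
(* With x = 16 s i <= 1/2, exp(x) - 1 <= x + 2 x^2 <= 2x. *)
have rho2 : rho - 1 <= 32 * s * i%:R.
  have := expR_le_quad hd; rewrite -rhoE.
  have : 16 * s * i%:R * (16 * s * i%:R) <= 16 * s * i%:R * (1 / 2) by rewrite ler_wpM2l.
  by rewrite expr2; lra.
have b' := binw_ge0 M k'; have b := binw_ge0 M k.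
apply: (@le_trans _ _ ((rho - 1) * binw M k')); last by rewrite ler_wpM2r.
have h3 : binw M k' - binw M k <= (rho - 1) * binw M k'.
  have [lt|ge] := leP (binw M k') (binw M k).
    apply: (@le_trans _ _ 0); first by rewrite subr_le0.
    by rewrite mulr_ge0 // subr_ge0.
  have : (rho - 1) * binw M k <= (rho - 1) * binw M k'.
    by rewrite ler_wpM2l ?subr_ge0 // ltW.
  lra.
by rewrite ler_norml; apply/andP; split; lra.
Qed.

End Ratio.
End Binomial.

(** * Coins and counts *)

Section UnifMean.
Variables (R : realType) (A : finType).
Implicit Types F G : A -> R.

Lemma eq_unif_mean F G : F =1 G -> unif_mean F = unif_mean G.
Proof. by move=> FG; congr (_ / _); apply: eq_bigr => a _. Qed.

Lemma le_unif_mean F G : (forall a, F a <= G a) -> unif_mean F <= unif_mean G.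
Proof. by move=> FG; rewrite ler_wpM2r ?invr_ge0 // ler_sum. Qed.

Lemma unif_mean_ge0 F : (forall a, 0 <= F a) -> 0 <= unif_mean F.
Proof. by move=> F0; rewrite divr_ge0 // sumr_ge0. Qed.

Lemma unif_meanB F G : unif_mean (fun a => F a - G a) = unif_mean F - unif_mean G.
Proof. by rewrite /unif_mean sumrB mulrBl. Qed.

Lemma unif_meanZr F (c : R) : unif_mean (fun a => F a * c) = unif_mean F * c.
Proof. by rewrite /unif_mean -mulr_suml mulrAC. Qed.

Lemma unif_mean_sum (I : finType) (F : I -> A -> R) :
  unif_mean (fun a => \sum_i F i a) = \sum_i unif_mean (F i).
Proof. by rewrite /unif_mean exchange_big /= mulr_suml. Qed.

Lemma unif_mean_cst (c : R) : (0 < #|A|)%N -> unif_mean (fun _ : A => c) = c.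
Proof.
move=> A0; rewrite /unif_mean sumr_const -[c *+ _]mulr_natr mulfK //.
by rewrite pnatr_eq0 -lt0n.
Qed.

Lemma unif_mean_le1 F : (0 < #|A|)%N -> (forall a, F a <= 1) -> unif_mean F <= 1.
Proof. by move=> A0 F1; rewrite -[leRHS](unif_mean_cst 1 A0) le_unif_mean. Qed.

End UnifMean.

(** * Uniform subsets and disjoint blocks *)

Section Blocks.
Variable R : realType.

(** A subset of A is the same as a family of subsets, one in each fibre of [lab]; the product of
    sums expands over such families. *)
Lemma sum_set_blocks (A J : finType) (lab : A -> J) (psi : J -> {set A} -> R) :
  \sum_(C : {set A}) \prod_j psi j (C :&: [set a | lab a == j]) =
  \prod_j \sum_(U : {set A} | U \subset [set a | lab a == j]) psi j U.
Proof.
pose B j := [set a | lab a == j].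
under [RHS]eq_bigr do rewrite big_mkcond.
rewrite bigA_distr_bigA /=.
rewrite [RHS](bigID (fun v : {ffun J -> {set A}} => [forall j, v j \subset B j])) /=.
rewrite [X in _ = _ + X]big1 ?addr0; last first.
  move=> v; rewrite negb_forall => /existsP[j vj].
  by rewrite (bigD1 j) //= (negPf vj) mul0r.
rewrite (reindex_onto (fun C : {set A} => [ffun j => C :&: B j])
  (fun v : {ffun J -> {set A}} => \bigcup_j v j)) /=; last first.
  move=> v /forallP vB; apply/ffunP => j; rewrite ffunE; apply/setP => a.
  rewrite !inE; apply/andP/idP => [[/bigcupP[i _ ai] /eqP laj]|aj].
    by have /subsetP/(_ a ai) := vB i; rewrite inE => /eqP li; rewrite -laj li.
  split; first by apply/bigcupP; exists j.
  by have /subsetP/(_ a aj) := vB j; rewrite inE.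
apply: eq_big => [C|C _].
  apply/esym/andP; split; first by apply/forallP => j; rewrite ffunE subsetIr.
  apply/eqP/setP => a; apply/bigcupP/idP => [[j _]|aC].
    by rewrite ffunE inE => /andP[].
  by exists (lab a) => //; rewrite ffunE !inE aC eqxx.
by apply: eq_bigr => j _; rewrite ffunE subsetIr.
Qed.

Lemma sum_subsets_card (A : finType) (B : {set A}) (phi : nat -> R) :
  \sum_(U : {set A} | U \subset B) phi #|U| = \sum_(h < #|B|.+1) 'C(#|B|, h)%:R * phi h.
Proof.
rewrite (partition_big (fun U : {set A} => inord #|U| : 'I_#|B|.+1) predT) //=.
apply: eq_bigr => h _.
rewrite -cards_draws; set S := finset _.
have -> : #|S|%:R = \sum_(U in S) 1 :> R by rewrite sumr_const.
rewrite mulr_suml /S.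
apply: eq_big => [U|U].
  rewrite inE; case: (boolP (U \subset B)) => //= UB.
  by rewrite -val_eqE /= inordK // ltnS subset_leq_card.
move=> /andP[UB /eqP <-]; rewrite mul1r inordK // ltnS subset_leq_card //.
Qed.

End Blocks.

Lemma block_sum (V : nmodType) (T M j : nat) (F : nat -> V) :
  (0 < M)%N -> (j.+1 * M <= T)%N ->
  \sum_(p < M) F (j * M + p)%N = \sum_(q < T | (q %/ M == j)%N) F q.
Proof.
move=> M0 hT; have jM : (j * M <= j.+1 * M)%N by rewrite leq_mul2r leqnSn orbT.
rewrite -(big_mkord (fun q => (q %/ M)%N == j) F).
rewrite (@big_cat_nat _ _ _ (j * M)%N) //=; last by apply: leq_trans hT.
rewrite (@big_cat_nat _ _ _ (j.+1 * M)%N (j * M)%N) //=.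
rewrite [X in _ = X + _]big_nat_cond [X in _ = X + _]big1 ?add0r; last first.
  by move=> q /andP[/andP[_ qj] /eqP qM]; move: qj; rewrite -ltn_divLR // qM ltnn.
rewrite [X in _ = _ + X]big_nat_cond [X in _ = _ + X]big1 ?addr0; last first.
  by move=> q /andP[/andP[qj _] /eqP qM]; move: qj; rewrite -leq_divRL // qM ltnn.
rewrite big_nat_cond (eq_bigl (fun q => (j * M <= q < j.+1 * M)%N)); last first.
  move=> q; case: (boolP (_ <= q < _)%N) => //= /andP[h1 h2].
  by apply/eqP/anti_leq; rewrite leq_divRL // h1 andbT -ltnS ltn_divLR.
rewrite -big_nat -[in RHS](add0n (j * M)%N) big_addn mulSn addnK big_mkord.
by apply: eq_bigr => p _; rewrite addnC.
Qed.

Section Coins.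
Variables (R : realType) (n T D M : nat).
Hypothesis M_gt0 : (0 < M)%N.
Hypothesis DMT : (D * M <= T)%N.

Definition heads (c : {ffun 'I_n -> T.-tuple bool}) (j : nat) : nat :=
  (\sum_(i < n) \sum_(p < M) nth false (c i) (j * M + p))%N.

Let coin := ('I_n * 'I_T)%type.
(** A user has T coins but the D cells consume only D M of them. The extra label D collects the
    unread ones, so that the blocks partition all coins. *)
Let lab (x : coin) : 'I_D.+1 := inord (minn (x.2 %/ M) D).
Let block (j : 'I_D.+1) : {set coin} := [set x | lab x == j].

Let heads_set (c : {ffun 'I_n -> T.-tuple bool}) : {set coin} :=
  [set x : coin | tnth (c x.1) x.2].
Let set_heads (C : {set coin}) : {ffun 'I_n -> T.-tuple bool} :=
  [ffun i => [tuple (i, p) \in C | p < T]].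

Let heads_setK : cancel heads_set set_heads.
Proof.
move=> c; apply/ffunP => i; apply/eq_from_tnth => p.
by rewrite ffunE tnth_mktuple inE.
Qed.

Let set_headsK : cancel set_heads heads_set.
Proof. by move=> C; apply/setP => -[i p]; rewrite inE /= ffunE tnth_mktuple. Qed.

Let labE (x : coin) (j : 'I_D) : (lab x == widen_ord (leqnSn D) j) = (x.2 %/ M == j)%N.
Proof.
rewrite -val_eqE /= inordK; last by rewrite ltnS geq_minr.
have := ltn_ord j; case: (leqP (x.2 %/ M) D) => // h1 h2.
by rewrite [RHS]gtn_eqF ?(ltn_trans h2) // [LHS]gtn_eqF.
Qed.

Let jMT (j : 'I_D) : (j.+1 * M <= T)%N.
Proof. by apply: leq_trans DMT; rewrite leq_mul2r ltn_ord orbT. Qed.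

Let headsE c (j : 'I_D) :
  #|heads_set c :&: block (widen_ord (leqnSn D) j)| = heads c j.
Proof.
rewrite -sum1_card (eq_bigl (fun x : coin => true && ((x.2 %/ M == j)%N && tnth (c x.1) x.2))).
  rewrite -(pair_big_dep predT (fun i (p : 'I_T) => (p %/ M == j)%N && tnth (c i) p)
    (fun _ _ => 1%N)) /=.
  apply: eq_bigr => i _.
  rewrite (block_sum (fun p => nat_of_bool (nth false (c i) p)) M_gt0 (jMT j)).
  rewrite big_mkcondr; apply: eq_bigr => p _.
  by rewrite (tnth_nth false); case: (nth _ _ _).
by move=> x; rewrite !inE labE andbC.
Qed.

Let card_block (j : 'I_D) : #|block (widen_ord (leqnSn D) j)| = (n * M)%N.
Proof.
rewrite -sum1_card (eq_bigl (fun x : coin => true && (x.2 %/ M == j)%N)).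
  rewrite -(pair_big_dep predT (fun i (p : 'I_T) => (p %/ M == j)%N) (fun _ _ => 1%N)) /=.
  rewrite -[RHS](card_ord (n * M)) card_ord.
  under eq_bigr do rewrite -(block_sum (fun=> 1%N) M_gt0 (jMT j)) sum1_card card_ord.
  by rewrite sum_nat_const card_ord.
by move=> x; rewrite inE labE.
Qed.

(** Coin outcomes correspond to the subsets of coins showing heads. A uniform subset meets disjoint
    blocks independently, and its intersection with a block of n M coins has binomial size. *)
Lemma heads_independent (phi : 'I_D -> nat -> R) :
  unif_mean (fun c => \prod_j phi j (heads c j)) =
  \prod_j \sum_(h < (n * M).+1) binw R (n * M) h * phi j h.
Proof.
have key (f : 'I_D -> nat -> R) :
    \sum_c \prod_j f j (heads c j) =
    (\prod_j \sum_(h < (n * M).+1) 'C(n * M, h)%:R * f j h) *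
    \sum_(U : {set coin} | U \subset block ord_max) 1.
  pose psi (j : 'I_D.+1) (U : {set coin}) : R :=
    if insub (val j) is Some j' then f j' #|U| else 1.
  have psiw (j : 'I_D) U : psi (widen_ord (leqnSn D) j) U = f j #|U|.
    by rewrite /psi /= insubT //= => lj; congr (f _ _); apply: val_inj.
  have psim U : psi ord_max U = 1 by rewrite /psi /= insubF //= ltnn.
  have := sum_set_blocks lab psi.
  rewrite big_ord_recr /= (eq_bigr (fun j => \sum_(h < (n * M).+1) 'C(n * M, h)%:R * f j h)).
    rewrite (eq_bigr (fun=> 1) (fun U _ => psim U)) => <-.
    rewrite (reindex set_heads) /=; last first.
      by exists heads_set => C _; [exact: set_headsK | exact: heads_setK].
    apply: eq_bigr => C _; rewrite big_ord_recr /= psim mulr1; apply: eq_bigr => j _.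
    by rewrite psiw -headsE set_headsK.
  move=> j _; rewrite -(card_block j) -sum_subsets_card.
  by apply: eq_bigr => U _; rewrite psiw.
rewrite /unif_mean key.
(* The same identity for constant functions expresses the number of outcomes with the same factor
   for the unread coins, which then cancels. *)
have := key (fun _ _ => 1).
rewrite (eq_bigr (fun _ : {ffun 'I_n -> T.-tuple bool} => 1)); last by move=> c _; rewrite big1.
rewrite sumr_const => cardE.
have N0 : #|{: {ffun 'I_n -> T.-tuple bool}}|%:R != 0 :> R.
  by rewrite pnatr_eq0 -lt0n; apply/card_gt0P; exists [ffun => [tuple false | _ < T]].
have pow2 : \sum_(h < (n * M).+1) 'C(n * M, h)%:R * 1 = 2 ^+ (n * M) :> R.
  have := binw_sum R (n * M); rewrite /binw -mulr_suml => /(congr1 ( *%R^~ (2 ^+ (n * M)))).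
  rewrite mul1r divfK ?expf_neq0 ?pnatr_eq0 // => <-.
  by apply: eq_bigr => h _; rewrite mulr1.
rewrite (eq_bigr (fun=> 2 ^+ (n * M)) (fun _ _ => pow2)) in cardE.
set s1 := \sum_(U | _) 1 in cardE *.
apply: (canLR (mulfK N0)); rewrite cardE mulrA; congr (_ * _).
rewrite -big_split; apply: eq_bigr => j _ /=.
rewrite mulr_suml; apply: eq_bigr => h _; rewrite /binw.
by rewrite mulrAC divfK // expf_neq0 // pnatr_eq0.
Qed.

Section Pushforward.
Variables (K : nat) (a : 'I_D -> nat).
Hypothesis aK : forall j, (a j + n * M <= K)%N.

Definition shifted_binw (b k : nat) : R :=
  if (b <= k)%N then binw R (n * M) (k - b) else 0.

Lemma heads_le c j : (heads c j <= n * M)%N.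
Proof.
rewrite -[X in (_ <= X * _)%N]card_ord -sum_nat_const leq_sum // => i _.
rewrite -[leqRHS]card_ord -[leqRHS]sum1_card leq_sum // => p _.
exact: leq_b1.
Qed.

Definition counts (c : {ffun 'I_n -> T.-tuple bool}) : {ffun 'I_D -> 'I_K.+1} :=
  [ffun j => inord (a j + heads c j)%N].

(** The bound [K] only makes the range of counts finite; by [aK] the truncation in [counts] never
    acts. *)
Lemma counts_pushforward (G : {ffun 'I_D -> 'I_K.+1} -> R) :
  unif_mean (fun c => G (counts c)) =
  \sum_(w : {ffun 'I_D -> 'I_K.+1}) (\prod_j shifted_binw (a j) (w j)) * G w.
Proof.
rewrite (eq_unif_mean (G := fun c => \sum_(w : {ffun 'I_D -> 'I_K.+1})
    (\prod_j (a j + heads c j == w j)%N%:R) * G w)).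
  rewrite unif_mean_sum; apply: eq_bigr => w _.
  rewrite unif_meanZr (heads_independent (fun j h => (a j + h == w j)%N%:R)).
  congr (_ * _); apply: eq_bigr => j _; rewrite /shifted_binw.
  case: ifP => aw; last first.
    apply: big1 => h _; case: eqP => [e|_]; last by rewrite mulr0.
    by move: aw; rewrite -e leq_addr.
  case: (ltnP (n * M) (w j - a j)) => hw.
    rewrite binw_small //; apply: big1 => h _; case: eqP => [e|_]; last by rewrite mulr0.
    by move: hw; rewrite -e addKn ltnNge -ltnS ltn_ord.
  rewrite (bigD1 (inord (w j - a j))) //= inordK // subnKC // eqxx mulr1 big1 ?addr0 //.
  move=> h hn; case: eqP => [e|_]; last by rewrite mulr0.
  by case/eqP: hn; apply: val_inj; rewrite /= inordK // -e addKn.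
move=> c; rewrite (bigD1 (counts c)) //= [X in X * _]big1 ?mul1r; last first.
  by move=> j _; rewrite ffunE inordK ?eqxx // ltnS (leq_trans _ (aK j)) // leq_add2l heads_le.
rewrite big1 ?addr0 // => w; rewrite eq_sym => /eqP wc.
case: (boolP [forall j, counts c j == w j]) => [/forallP h|].
  by case: wc; apply/ffunP => j; apply/eqP.
rewrite negb_forall => /existsP[j]; rewrite ffunE => hj.
rewrite (bigD1 j) //=; case: eqP => [e|_]; last by rewrite !mul0r.
by move: hj; rewrite e inord_val eqxx.
Qed.

End Pushforward.
End Coins.

(** * Shuffling and hashing *)

Section Shuffle.
Variable R : realType.
Implicit Type f : seq nat -> R.

Lemma card_perm_gt0 n : (0 < #|{: {perm 'I_n}}|)%N.
Proof. by apply/card_gt0P; exists 1%g. Qed.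

Lemma shuffle_meanE n (ms : seq nat) f : n = size ms ->
  shuffle_mean ms f = unif_mean (fun s : {perm 'I_n} =>
    f [seq nth 0%N ms (s i) | i <- enum 'I_n]).
Proof. by move=> ->. Qed.

(** A permutation relating the two lists is absorbed by translating the uniform permutation. Hence
    the shuffler reveals nothing beyond the multiset of messages. *)
Lemma shuffle_mean_perm (s t : seq nat) f :
  perm_eq s t -> shuffle_mean s f = shuffle_mean t f.
Proof.
move=> st; have sz := esym (perm_size st).
have /tuple_permP[p sE] : perm_eq s (in_tuple t) by [].
rewrite (shuffle_meanE f sz) /shuffle_mean /unif_mean; congr (_ / _).
rewrite [RHS](reindex_inj (mulIg p)) /=; apply: eq_bigr => x _; congr f.
apply: eq_map => i; rewrite permM {1}sE -(tnth_nth 0%N).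
by rewrite tnth_mktuple (tnth_nth 0%N).
Qed.

Lemma shuffle_perm_eq n (ms : seq nat) (s : {perm 'I_n}) : n = size ms ->
  perm_eq [seq nth 0%N ms (s i) | i <- enum 'I_n] ms.
Proof.
move=> nE; subst n.
have -> : [seq nth 0%N ms (s i) | i <- enum 'I_(size ms)] =
    [tuple tnth (in_tuple ms) (s i) | i < size ms].
  by apply: eq_map => i; rewrite (tnth_nth 0%N).
by apply/(tuple_permP (t := in_tuple ms)); exists s.
Qed.

Lemma shuffle_mean_cst (ms : seq nat) f (c : R) :
  (forall t, perm_eq t ms -> f t = c) -> shuffle_mean ms f = c.
Proof.
move=> fc; rewrite -(unif_mean_cst c (card_perm_gt0 (size ms))).
by apply: eq_unif_mean => s; apply: fc; exact: shuffle_perm_eq.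
Qed.

Lemma shuffle_mean01 (ms : seq nat) f :
  (forall t, 0 <= f t <= 1) -> 0 <= shuffle_mean ms f <= 1.
Proof.
move=> f01; apply/andP; split.
  by apply: unif_mean_ge0 => s; case/andP: (f01 [seq nth 0%N ms (s i) | i <- enum 'I_(size ms)]).
apply: unif_mean_le1 => [|s]; first exact: card_perm_gt0.
by case/andP: (f01 [seq nth 0%N ms (s i) | i <- enum 'I_(size ms)]).
Qed.

End Shuffle.

Section Hash.
Variable L : nat.

(** Binary digits, most significant first, written as the comparison that the machine can make: the
    current remainder against a halved power of two. *)
Definition ybit (y l : nat) : bool := (2 ^ (L - l.+1) <= y %% 2 ^ (L - l))%N.

(** Row i of a random F_2-matrix occupies the coins from i L on. The partial product over the first
    l digits is kept as a notion because it is the state of the parity register after l passes. *)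
Definition hash_bit (r : seq bool) (y i l : nat) : bool :=
  \big[addb/false]_(j < l) (ybit y j && nth false r (i * L + j)).

Definition hash (r : seq bool) (y k : nat) : nat :=
  (\sum_(i < k) 2 ^ i * hash_bit r y i L)%N.

Lemma ybit_rem y l : (l < L)%N ->
  (y %% 2 ^ (L - l.+1) = if ybit y l then y %% 2 ^ (L - l) - 2 ^ (L - l.+1)
                         else y %% 2 ^ (L - l))%N.
Proof.
move=> lL; rewrite /ybit; set p := (2 ^ (L - l.+1))%N.
have p0 : (0 < p)%N by rewrite expn_gt0.
have pE : (2 ^ (L - l) = 2 * p)%N by rewrite /p -expnS subnSK.
rewrite pE; set q := (y %% (2 * p))%N.
have qlt : (q < 2 * p)%N by rewrite ltn_mod muln_gt0.
have <- : (q %% p = y %% p)%N by rewrite modn_dvdm // dvdn_mull.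
case: leqP => hq; last by rewrite modn_small.
have {1}-> : q = (q - p + p)%N by rewrite subnK.
by rewrite modnDr modn_small // ltn_subLR // addnn -mul2n.
Qed.

Lemma ybit_inj y y' : (y < 2 ^ L)%N -> (y' < 2 ^ L)%N -> y != y' ->
  exists2 l, (l < L)%N & ybit y l != ybit y' l.
Proof.
move=> hy hy' yy'; apply/exists2P.
apply: contrapT => /forallNP no.
have same l : (l < L)%N -> ybit y l = ybit y' l.
  by move=> lL; have := no l => /not_andP[//|/negP]; rewrite negbK => /eqP.
case/eqP: yy'.
have main i : (i <= L)%N -> (y %% 2 ^ i = y' %% 2 ^ i)%N.
  elim: i => [|i IH] iL; first by rewrite expn0 !modn1.
  have hl : (L - i.+1 < L)%N by lia.
  have e1 : (L - (L - i.+1).+1 = i)%N by lia.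
  have e2 : (L - (L - i.+1) = i.+1)%N by lia.
  have := ybit_rem y hl; have := ybit_rem y' hl; have := same _ hl.
  rewrite /ybit e1 e2; have := IH (ltnW iL).
  by case: leqP => h1; case: leqP => h2 //; lia.
by have := main L (leqnn L); rewrite !modn_small.
Qed.

Lemma hash_lt r y k : (hash r y k < 2 ^ k)%N.
Proof.
rewrite /hash; elim: k => [|k IH]; first by rewrite big_ord0.
rewrite big_ord_recr /= expnS mul2n -addnn -addSn leq_add //.
by rewrite -[leqRHS]muln1 leq_mul2l leq_b1 orbT.
Qed.

Lemma hash_inj r y y' k : hash r y k = hash r y' k ->
  forall i, (i < k)%N -> hash_bit r y i L = hash_bit r y' i L.
Proof.
elim: k => [|k IH] //; rewrite /hash !big_ord_recr /= => e i.
have := hash_lt r y k; have := hash_lt r y' k; move: e IH; rewrite /hash.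
set a := (\sum_(_ < _) _)%N; set b := (\sum_(_ < _) _)%N => e IH h1 h2.
have ek : hash_bit r y k L = hash_bit r y' k L.
  by move: e h1 h2; case: (hash_bit r y k L); case: (hash_bit r y' k L); lia.
rewrite ltnS leq_eqVlt => /orP[/eqP -> //|ik]; apply: IH => //.
by move: e; rewrite ek => /addIn.
Qed.

End Hash.

(** * Collision probability of the linear hash *)

Section Collision.
Variables (R : realType) (L k T : nat) (y y' : nat).
Hypothesis kLT : (k * L <= T)%N.
Hypothesis yL : (y < 2 ^ L)%N.
Hypothesis yL' : (y' < 2 ^ L)%N.
Hypothesis yy' : y != y'.

Section Toggle.
Variable l0 : nat.

Let toggle_at (w : {ffun 'I_k -> bool}) (p : nat) : bool :=
  (p %% L == l0)%N && (if insub (p %/ L)%N is Some i then w i else false).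

(** Adds the vector w to column l0 of the random matrix. *)
Definition toggle (w : {ffun 'I_k -> bool}) (r : T.-tuple bool) : T.-tuple bool :=
  [tuple tnth r p (+) toggle_at w p | p < T].

Lemma toggleK w : involutive (toggle w).
Proof.
move=> r; apply: eq_from_tnth => p; rewrite !tnth_mktuple.
by rewrite -addbA addbb addbF.
Qed.

Lemma hash_bit_toggle w r z (i : 'I_k) : (l0 < L)%N ->
  hash_bit L (toggle w r) z i L = hash_bit L r z i L (+) (ybit L z l0 && w i).
Proof.
move=> l0L; rewrite /hash_bit.
have -> : ybit L z l0 && w i =
    \big[addb/false]_(j < L) (ybit L z j && ((j == l0 :> nat) && w i)).
  rewrite (bigD1 (Ordinal l0L)) //= eqxx big1 ?addbF // => j jl.
  by move: jl; rewrite -val_eqE /= => /negPf ->; rewrite andbF.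
rewrite -big_split /=; apply: eq_bigr => j _.
have L0 : (0 < L)%N by apply: leq_ltn_trans l0L.
have lt : (i * L + j < T)%N.
  apply: leq_trans kLT; apply: (@leq_trans (i.+1 * L)).
    by rewrite mulSn addnC ltn_add2r.
  by rewrite leq_mul2r ltn_ord orbT.
have -> : nth false (toggle w r) (i * L + j) = tnth (toggle w r) (Ordinal lt).
  by rewrite (tnth_nth false).
rewrite tnth_mktuple (tnth_nth false) /= /toggle_at modnMDl modn_small //.
rewrite divnMDl // divn_small // addn0 valK.
by case: (ybit _ _ _) => //=.
Qed.

End Toggle.

(** Let l0 be a digit where y and y' differ. Adding w to column l0 changes exactly one of the two
    hashes, by w, so for each r at most one of the 2^k vectors w yields a collision; averaging over
    the measure-preserving toggles gives the bound without any rank argument. *)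
Lemma hash_collision :
  unif_mean (fun r : T.-tuple bool => (hash L r y k == hash L r y' k)%:R) <= (2 ^+ k)^-1 :> R.
Proof.
have [l0 l0L bitN] := ybit_inj yL yL' yy'.
pose coll (r : T.-tuple bool) : R := (hash L r y k == hash L r y' k)%:R.
have key : 2 ^+ k * \sum_r coll r <= \sum_(r : T.-tuple bool) 1.
  have -> : 2 ^+ k * \sum_r coll r =
      \sum_(w : {ffun 'I_k -> bool}) \sum_r coll (toggle l0 w r).
    rewrite [RHS](eq_bigr (fun=> \sum_r coll r)); last first.
      by move=> w _; rewrite [RHS](reindex_inj (inv_inj (toggleK l0 w))).
    by rewrite sumr_const card_ffun card_bool card_ord -[RHS]mulr_natl natrX.
  rewrite exchange_big /=; apply: ler_sum => r _.
  pose w0 : {ffun 'I_k -> bool} := [ffun i : 'I_k => hash_bit L r y i L (+) hash_bit L r y' i L].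
  apply: (@le_trans _ _ (\sum_(w : {ffun 'I_k -> bool}) (w == w0)%:R)).
    apply: ler_sum => w _; rewrite /coll ler_nat.
    case: eqP => // /hash_inj h; rewrite lt0b; apply/eqP/ffunP => i.
    have := h i (ltn_ord i); rewrite !hash_bit_toggle // ffunE.
    move: bitN; case: (ybit L y l0); case: (ybit L y' l0) => //= _;
      by case: (w i); case: (hash_bit L r y i L); case: (hash_bit L r y' i L).
  by rewrite (bigD1 w0) //= eqxx big1 ?addr0 // => w /negPf ->.
have N0 : 0 < #|{: T.-tuple bool}|%:R :> R.
  by rewrite ltr0n; apply/card_gt0P; exists [tuple false | _ < T].
rewrite sumr_const in key.
by rewrite /unif_mean ler_pdivrMr // mulrC ler_pdivlMr ?exprn_gt0 // mulrC.
Qed.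

End Collision.

(** * Programs *)

(** The number of passes of a loop that counts until p holds; the value 0 for an empty p is only a
    default. *)
Definition least (p : pred nat) : nat :=
  if pselect (exists n, p n) is left h then ex_minn h else 0%N.

Lemma leastP (p : pred nat) n : p n -> p (least p).
Proof.
by move=> pn; rewrite /least; case: pselect => [h|[]]; [case: ex_minnP | exists n].
Qed.

Lemma least_le (p : pred nat) n : p n -> (least p <= n)%N.
Proof.
move=> pn; rewrite /least; case: pselect => [h|[]]; last by exists n.
by case: ex_minnP => m _; apply.
Qed.

Lemma least_min (p : pred nat) i : (i < least p)%N -> ~~ p i.
Proof.
rewrite /least; case: pselect => // h; case: ex_minnP => m _ hm im.
by apply/negP => /hm; rewrite leqNgt im.
Qed.

Section Exec.
Variable R : realType.
Implicit Types (s : state R) (c : cmd) (t : nat).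

(** Quantifying over the rest of the stack makes executions compose, and the slack between u and t
    allows costs to be rounded up. *)
Definition exec c s t s' : Prop :=
  exists2 u, (u <= t)%N & forall k, iter u (@step R) (c :: k, s) = (k, s').

Lemma exec_le c s t t' s' : exec c s t s' -> (t <= t')%N -> exec c s t' s'.
Proof. by case=> u ut h tt'; exists u => //; apply: leq_trans tt'. Qed.

Lemma exec_step c s s' : (forall k, step (c :: k, s) = (k, s')) -> exec c s 1 s'.
Proof. by move=> h; exists 1%N. Qed.

Lemma exec_skip s : exec CSkip s 1 s.
Proof. exact: exec_step. Qed.

Lemma exec_seq c1 c2 s t1 s1 t2 s2 :
  exec c1 s t1 s1 -> exec c2 s1 t2 s2 -> exec (CSeq c1 c2) s (t1 + t2).+1 s2.
Proof.
move=> [u1 h1 e1] [u2 h2 e2]; exists (u2 + u1).+1; first by rewrite ltnS addnC leq_add.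
by move=> k; rewrite iterSr /= iterD e1 e2.
Qed.

Lemma exec_if b c1 c2 s t s' :
  exec (if beval s b then c1 else c2) s t s' -> exec (CIf b c1 c2) s t.+1 s'.
Proof. by move=> [u h e]; exists u.+1 => // k; rewrite iterSr /= e. Qed.

(** The loop is described by its whole trajectory of states instead of an invariant predicate, which
    yields the final state and the cost together: one test per pass and one failing test at the
    end. *)
Lemma exec_while N (st : nat -> state R) b c t :
  (forall i, (i < N)%N -> beval (st i) b /\ exec c (st i) t (st i.+1)) ->
  ~~ beval (st N) b ->
  exec (CWhile b c) (st 0%N) (t.+1 * N).+1 (st N).
Proof.
move=> hb hN.
suff main j : (j <= N)%N -> exec (CWhile b c) (st (N - j)%N) (t.+1 * j).+1 (st N).
  by have := main N (leqnn N); rewrite subnn.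
elim: j => [|j IH] hj.
  by rewrite subn0 muln0; apply: exec_step => k /=; rewrite (negPf hN).
have lt : (N - j.+1 < N)%N by lia.
have [b1 [u1 h1 e1]] := hb _ lt.
have [u2 h2 e2] := IH (ltnW hj).
exists (u2 + u1).+1; first by rewrite mulnS; lia.
move=> k; rewrite iterSr /= b1 iterD e1.
by have -> : (N - j.+1).+1 = (N - j)%N by lia.
Qed.

Lemma run_exec c s t s' T : exec c s t s' -> (t <= T)%N -> run T c s = ([::], s').
Proof.
move=> [u ut e] tT; have uT := leq_trans ut tT.
rewrite /run -(subnK uT) iterD e; elim: (T - u)%N => // j IH.
by rewrite iterS IH.
Qed.

Lemma upd_nth (A : Type) (x0 : A) l i v : upd (nth x0 l) i v = nth x0 (set_nth x0 l i v).
Proof. by apply/funext => j; rewrite nth_set_nth /= /upd. Qed.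

Definition block (cs : seq cmd) : cmd := foldr CSeq CSkip cs.

Section Primitive.
Variables (l : seq nat) (rl : seq R) (ia : nat -> nat) (ra : nat -> R).
Variables (pv pb : seq bool) (sn : seq nat).
Let S := State (nth 0%N l) (nth 0 rl) ia ra pv pb sn.

Lemma exec_iset i e : exec (CISet i e) S 1
  (State (nth 0%N (set_nth 0%N l i (ieval S e))) (nth 0 rl) ia ra pv pb sn).
Proof. by apply: exec_step => k; rewrite /= /set_ireg upd_nth. Qed.

Lemma exec_rset i e : exec (CRSet i e) S 1
  (State (nth 0%N l) (nth 0 (set_nth 0 rl i (reval S e))) ia ra pv pb sn).
Proof. by apply: exec_step => k; rewrite /= /set_rreg upd_nth. Qed.

Lemma exec_rstore a e : exec (CRStore a e) S 1
  (State (nth 0%N l) (nth 0 rl) ia (upd ra (ieval S a) (reval S e)) pv pb sn).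
Proof. exact: exec_step. Qed.

Lemma exec_flip i : exec (CFlip i) S 1
  (State (nth 0%N (set_nth 0%N l i (nat_of_bool (head false pv)))) (nth 0 rl) ia ra
    (behead pv) pb sn).
Proof. by apply: exec_step => k; rewrite /= /flip_priv upd_nth. Qed.

Lemma exec_flippub i : exec (CFlipPub i) S 1
  (State (nth 0%N (set_nth 0%N l i (nat_of_bool (head false pb)))) (nth 0 rl) ia ra
    pv (behead pb) sn).
Proof. by apply: exec_step => k; rewrite /= /flip_pub upd_nth. Qed.

Lemma exec_send e : exec (CSend e) S 1
  (State (nth 0%N l) (nth 0 rl) ia ra pv pb (rcons sn (ieval S e))).
Proof. exact: exec_step. Qed.

End Primitive.
End Exec.

Ltac xprim := first
  [ eapply exec_iset | eapply exec_rset | eapply exec_rstore | eapply exec_flip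
  | eapply exec_flippub | eapply exec_send | eapply exec_skip ].
Ltac xone := eapply exec_seq; [ xprim | rewrite /= ].
Ltac xall := repeat xone; eapply exec_skip.

Lemma behead_drop (r : seq bool) i : behead (drop i r) = drop i.+1 r.
Proof. by rewrite -drop1 drop_drop add1n. Qed.

Lemma head_drop (r : seq bool) i : head false (drop i r) = nth false r i.
Proof. by rewrite -nth0 nth_drop addn0. Qed.

(* Nat registers: 0-4 n, d, |Y|, y, number of messages; 5 base; 6 width;
   7 parity; 8 coin; 9 l; 10 e; 11 g; 12 number of coins per cell; 13 cell;
   14, 15 counters.  Real registers: 0-2 eps, delta, beta; 3-6 scratch.
   Scratch registers are reset after use, so that loop states are explicit. *)

Definition pad_regs : seq cmd :=
  [:: CISet 15 (ICst 0); CRSet 6 (ROfNat (ICst 0)); CRSet 5 (ROfNat (ICst 1))].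

Definition power_prog : cmd :=
  CWhile (BNot (BLer (ROfNat (IReg 2)) (RReg 4)))
    (CRSet 4 (RAdd (RReg 4) (RReg 4))).

(** The public coin is read on every pass, even when the digit is 0, so its position depends only on
    the loop indices and all users and the analyzer use the same matrix. Halving is done on reals
    because natural numbers have no division. *)
Definition hash_bit_body : cmd := block
  [:: CRSet 5 (RMul (RReg 5) (RInv (ROfNat (ICst 2))));
      CFlipPub 8;
      CIf (BLer (RReg 5) (RReg 6))
        (block [:: CRSet 6 (RAdd (RReg 6) (ROpp (RReg 5)));
                   CIf (BLei (ICst 1) (IReg 8))
                     (CISet 7 (ISub (ICst 1) (IReg 7))) CSkip])
        CSkip;
      CISet 8 (ICst 0)].

Definition hash_bit_prog : cmd :=
  CWhile (BNot (BLer (RReg 5) (ROfNat (ICst 1)))) hash_bit_body.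

Definition hash_body : cmd := block
  [:: CRSet 5 (RReg 4);
      CRSet 6 (ROfNat (IReg 3));
      hash_bit_prog;
      CIf (BLei (ICst 1) (IReg 7)) (CISet 5 (IAdd (IReg 5) (IReg 6))) CSkip;
      CISet 7 (ICst 0);
      CISet 6 (IAdd (IReg 6) (IReg 6));
      CRSet 3 (RAdd (RReg 3) (RReg 3))].

Definition hash_prog : cmd :=
  CWhile (BNot (BLer (ROfNat (IAdd (IReg 0) (IReg 0))) (RReg 3))) hash_body.

Definition log_prog : cmd :=
  CWhile (BNot (BLer (RMul (ROfNat (ICst 64)) (ROfNat (IReg 1))) (RReg 3)))
    (block [:: CISet 9 (IAdd (IReg 9) (ICst 1));
               CRSet 3 (RAdd (RReg 3) (RReg 3))]).

Definition inveps_prog : cmd :=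
  CWhile (BAnd (BNot (BLer (ROfNat (ICst 1)) (RMul (ROfNat (IReg 10)) (RReg 0))))
               (BNot (BLer (ROfNat (ICst 4)) (RMul (ROfNat (IReg 10)) (RReg 1)))))
    (CISet 10 (IAdd (IReg 10) (ICst 1))).

Definition rsq (e : rexp) : rexp := RMul e e.

(** This is 40 l / s^2 for the noise level s = 1/(512 g e l). *)
Definition coins_target : rexp :=
  RMul (RMul (ROfNat (ICst 40)) (ROfNat (IReg 9)))
    (rsq (RMul (RMul (ROfNat (ICst 512)) (ROfNat (IReg 11)))
               (RMul (ROfNat (IReg 10)) (ROfNat (IReg 9))))).

Definition coins_prog : cmd :=
  CWhile (BNot (BLer coins_target (RMul (ROfNat (IReg 0)) (ROfNat (IReg 12)))))
    (CISet 12 (IAdd (IReg 12) (ICst 1))).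

Definition setup : seq cmd :=
  pad_regs ++
  [:: CRSet 4 (ROfNat (ICst 1));
      power_prog;
      CISet 6 (IReg 1);
      CRSet 3 (RReg 2);
      hash_prog;
      CRSet 3 (RMul (RReg 1) (RReg 2));
      log_prog;
      inveps_prog;
      CISet 11 (IAdd (IReg 0) (IReg 1));
      coins_prog;
      CRSet 5 (ROfNat (ICst 0))].

(** Counting up to g (1 + v) computes its ceiling without a floor operation. *)
Definition value_loop : cmd :=
  CWhile (BNot (BLer (RMul (ROfNat (IReg 11)) (RAdd (ROfNat (ICst 1)) (RReg 5)))
                     (ROfNat (IReg 14))))
    (block [:: CSend (IReg 13); CISet 14 (IAdd (IReg 14) (ICst 1))]).

Definition noise_loop : cmd :=
  CWhile (BNot (BLei (IReg 12) (IReg 14)))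
    (block [:: CFlip 8;
               CIf (BLei (ICst 1) (IReg 8)) (CSend (IReg 13)) CSkip;
               CISet 8 (ICst 0);
               CISet 14 (IAdd (IReg 14) (ICst 1))]).

(** Only the lower end of the class needs a test: input cells past coordinate d hold 0, which is the
    value wanted beyond the upper end. *)
Definition cell_body : cmd := block
  [:: CIf (BLei (IReg 5) (IReg 13))
        (CRSet 5 (RLoad (ISub (IReg 13) (IReg 5)))) CSkip;
      value_loop;
      CISet 14 (ICst 0);
      noise_loop;
      CISet 14 (ICst 0);
      CRSet 5 (ROfNat (ICst 0));
      CISet 13 (IAdd (IReg 13) (ICst 1))].

Definition cells_loop : cmd := CWhile (BNot (BLei (IReg 6) (IReg 13))) cell_body.

Definition count_loop : cmd :=
  CWhile (BNot (BLei (IReg 4) (IReg 14)))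
    (block [:: CIf (BAnd (BLei (ILoad (IReg 14)) (IAdd (IReg 5) (IReg 13)))
                         (BLei (IAdd (IReg 5) (IReg 13)) (ILoad (IReg 14))))
                 (CISet 15 (IAdd (IReg 15) (ICst 1))) CSkip;
               CISet 14 (IAdd (IReg 14) (ICst 1))]).

(** Every user, whatever the bucket, adds g and on average M/2 copies to the cell; removing this
    baseline and dividing by g leaves the sum. *)
Definition estimate_exp : rexp :=
  RMul (RAdd (ROfNat (IReg 15))
             (ROpp (RMul (ROfNat (IReg 0))
                (RAdd (ROfNat (IReg 11))
                      (RMul (ROfNat (IReg 12)) (RInv (ROfNat (ICst 2))))))))
       (RInv (ROfNat (IReg 11))).

Definition estimate_body : cmd := block
  [:: count_loop;
      CRStore (IReg 13) estimate_exp;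
      CISet 14 (ICst 0);
      CISet 15 (ICst 0);
      CISet 13 (IAdd (IReg 13) (ICst 1))].

Definition estimate_loop : cmd := CWhile (BNot (BLei (IReg 1) (IReg 13))) estimate_body.

(* If eps * n <= 1 the zero estimate is already accurate. *)
Definition guard (c : cmd) : cmd :=
  CIf (BLer (RMul (RReg 0) (ROfNat (IReg 0))) (ROfNat (ICst 1))) CSkip c.

Lemma exec_guard (R : realType) c (s : state R) t s' :
  ~~ (rreg s 0 * (ireg s 0)%:R <= 1) -> exec c s t s' -> exec (guard c) s t.+1 s'.
Proof. by move=> h hc; apply: exec_if; rewrite [beval _ _](negPf h). Qed.

Definition encoder : cmd := guard (block (setup ++ [:: cells_loop])).
Definition decoder : cmd := guard (block (setup ++ [:: estimate_loop])).

(** * Execution of the programs *)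

Section Programs.
Variables (R : realType) (n d Y y m : nat) (ep de be : R) (ia : nat -> nat).
Hypothesis ep_gt0 : 0 < ep.
Hypothesis de_gt0 : 0 < de.
Hypothesis be_gt0 : 0 < be.
Hypothesis n_gt0 : (0 < n)%N.

Definition dbl_steps (x z : R) : nat := least (fun i => z <= x * 2 ^+ i).

Lemma dbl_stepsP (x z : R) : 0 < x -> z <= x * 2 ^+ dbl_steps x z.
Proof.
move=> x0; pose N := Num.truncn (z / x).
apply: (@leastP (fun i => z <= x * 2 ^+ i) N.+1).
rewrite mulrC -ler_pdivrMr //.
apply: (@le_trans _ _ N.+1%:R); first by rewrite ltW // truncnS_gt.
by rewrite -natrX ler_nat ltnW // ltn_expl.
Qed.

Lemma natceilP (x z : R) : 0 < x -> exists i : nat, z <= i%:R * x.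
Proof.
move=> x0; exists (Num.truncn (z / x)).+1.
by rewrite -ler_pdivrMr // ltW // truncnS_gt.
Qed.

Definition ybits : nat := dbl_steps 1 Y%:R.
Definition hbits : nat := dbl_steps be (n + n)%:R.
Definition loglen : nat := dbl_steps (de * be) (64 * d%:R).
Definition inveps : nat := least (fun e => (1 <= e%:R * ep) || (4 <= e%:R * de)).
Definition scale : nat := (n + d)%N.
Definition coins_needed : R :=
  40 * loglen%:R * ((512 * scale%:R * (inveps%:R * loglen%:R)) ^+ 2).
Definition ncoins : nat := least (fun k => coins_needed <= n%:R * k%:R).

Local Notation St il rl ra pv pb sn :=
  (State (nth 0%N [:: n, d, Y, y, m & il%N]) (nth 0 [:: ep, de, be & rl]) ia ra pv pb sn).

Lemma exec_power il a b c ra pv pb sn :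
  exec power_prog (St il [:: a; 1; b; c] ra pv pb sn) (2 * ybits).+1
    (St il [:: a; 2 ^+ ybits; b; c] ra pv pb sn).
Proof.
rewrite -[1 in X in exec _ X](expr0 2).
apply: (exec_while (st := fun i => St il [:: a; 2 ^+ i; b; c] ra pv pb sn)).
  move=> i hi; split.
    by have := least_min hi; rewrite mul1r.
  have -> : 2 ^+ i.+1 = 2 ^+ i + 2 ^+ i :> R by rewrite exprS mulr_natl mulr2n.
  exact: exec_rset.
by rewrite /= negbK -[leRHS]mul1r dbl_stepsP.
Qed.

Section HashExec.
Variables (r : seq bool).
Hypothesis yY : (y < 2 ^ ybits)%N.
Let L := ybits.
Let pub_at (i j : nat) := drop (i * L + j) r.

(** After j passes the scratch registers hold 2^(L-j) and the remainder of y modulo 2^(L-j), so the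
    comparison made by the program is literally [ybit]. *)
Lemma exec_hash_bit (base w l e g k id c cnt : nat) a i ra pv sn :
  exec hash_bit_prog
    (St [:: base; w; 0; 0; l; e; g; k; id; c; cnt] [:: a; 2 ^+ L; 2 ^+ L; y%:R]
        ra pv (pub_at i 0) sn) (18 * L).+1
    (St [:: base; w; nat_of_bool (hash_bit L r y i L); 0; l; e; g; k; id; c; cnt]
        [:: a; 2 ^+ L; 1; 0] ra pv (pub_at i L) sn).
Proof.
pose st j := St [:: base; w; nat_of_bool (hash_bit L r y i j); 0; l; e; g; k; id; c; cnt]
  [:: a; 2 ^+ L; 2 ^+ (L - j); (y %% 2 ^ (L - j))%:R] ra pv (pub_at i j) sn.
have st0 : st 0%N = St [:: base; w; 0; 0; l; e; g; k; id; c; cnt]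
    [:: a; 2 ^+ L; 2 ^+ L; y%:R] ra pv (pub_at i 0) sn.
  by rewrite /st /hash_bit big_ord0 subn0 modn_small.
have stL : st L = St [:: base; w; nat_of_bool (hash_bit L r y i L); 0; l; e; g; k; id; c; cnt]
    [:: a; 2 ^+ L; 1; 0] ra pv (pub_at i L) sn.
  by rewrite /st subnn expr0 expn0 modn1.
rewrite -st0 -stL; apply: exec_while; last first.
  by rewrite stL /= negbK lexx.
move=> j jL; split.
  rewrite /= -ltNge; have -> : (L - j = (L - j.+1).+1)%N by lia.
  by rewrite exprn_egt1 // ltr1n.
rewrite /st; set p := (2 ^ (L - j.+1))%N.
have half : 2 ^+ (L - j) * 2%:R^-1 = p%:R :> R.
  have -> : (L - j = (L - j.+1).+1)%N by lia.
  by rewrite exprSr mulfK ?pnatr_eq0 // natrX.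
have remE := ybit_rem y jL; rewrite -/p in remE.
have hbE : hash_bit L r y i j.+1 =
    hash_bit L r y i j (+) (ybit L y j && nth false r (i * L + j)).
  by rewrite /hash_bit big_ord_recr.
eapply exec_le.
  xone; xone; rewrite half head_drop behead_drop.
  apply: (exec_seq (t1 := 7) (s1 := St [:: base; w; nat_of_bool (hash_bit L r y i j.+1);
      nat_of_bool (nth false r (i * L + j)); l; e; g; k; id; c; cnt]
      [:: a; 2 ^+ L; p%:R; (y %% p)%:R] ra pv (drop (i * L + j).+1 r) sn)).
    apply: exec_if; rewrite /= ler_nat -/(ybit L y j) hbE.
    case: ifP remE => [yb|yb] remE; last first.
      rewrite addbF remE.
      by apply: exec_le; first exact: exec_skip.
    have le : (p <= y %% 2 ^ (L - j))%N by exact: yb.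
    eapply exec_le.
      xone; rewrite -natrB // -remE.
      apply: (exec_seq (t1 := 2)); last exact: exec_skip.
      apply: exec_if => /=.
      case: (nth false r (i * L + j)) => /=.
        rewrite addbT.
        have -> : nat_of_bool (~~ hash_bit L r y i j) = (1 - hash_bit L r y i j)%N.
          by case: (hash_bit L r y i j).
        exact: exec_iset.
      by rewrite addbF; exact: exec_skip.
    by [].
  xone.
  have -> : 2 ^+ (L - j.+1) = p%:R :> R by rewrite natrX.
  by rewrite /pub_at addnS; exact: exec_skip.
by [].
Qed.

Lemma exec_hash (l e g k id c cnt : nat) ra pv sn :
  exec hash_prog
    (St [:: 0%N; d; 0; 0; l; e; g; k; id; c; cnt] [:: be; 2 ^+ L; 1; 0]
        ra pv r sn) ((18 * L + 22) * hbits).+1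
    (St [:: (d * hash L r y hbits)%N; (d * 2 ^ hbits)%N; 0; 0; l; e; g; k; id; c; cnt]
        [:: be * 2 ^+ hbits; 2 ^+ L; 1; 0] ra pv (drop (hbits * L) r) sn).
Proof.
pose st i := St [:: (d * hash L r y i)%N; (d * 2 ^ i)%N; 0; 0; l; e; g; k; id; c; cnt]
        [:: be * 2 ^+ i; 2 ^+ L; 1; 0] ra pv (drop (i * L) r) sn.
have st0 : st 0%N = St [:: 0%N; d; 0; 0; l; e; g; k; id; c; cnt] [:: be; 2 ^+ L; 1; 0]
        ra pv r sn.
  by rewrite /st /hash big_ord0 muln0 expn0 muln1 expr0 mulr1 mul0n drop0.
rewrite -st0; eapply exec_le; first apply: (exec_while (N := hbits) (t := (18 * L + 21)%N)).
- move=> i hi; split.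
    by have := least_min hi.
  rewrite /st; eapply exec_le.
    xone; xone; eapply exec_seq.
      rewrite -[(i * L)%N]addn0; exact: exec_hash_bit.
    apply: (exec_seq (t1 := 2) (s1 := St [:: (d * hash L r y i.+1)%N; (d * 2 ^ i)%N;
         nat_of_bool (hash_bit L r y i L); 0; l; e; g; k; id; c; cnt]
        [:: be * 2 ^+ i; 2 ^+ L; 1; 0] ra pv (drop (i.+1 * L) r) sn)).
      apply: exec_if => /=.
      rewrite /pub_at mulSn [(L + _)%N]addnC /hash big_ord_recr /= mulnDr -/(hash L r y i).
      case: (hash_bit L r y i L) => /=.
        by rewrite muln1; exact: exec_iset.
      by rewrite !muln0 addn0; exact: exec_skip.
    xone; xone; xone.
    have -> : (d * 2 ^ i.+1 = d * 2 ^ i + d * 2 ^ i)%N by rewrite expnS; lia.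
    have -> : be * 2 ^+ i.+1 = be * 2 ^+ i + be * 2 ^+ i by rewrite exprS; ring.
    exact: exec_skip.
  by lia.
- by rewrite /= negbK dbl_stepsP.
- by lia.
Qed.

End HashExec.

Lemma exec_log base w e g k id c cnt b x z ra pv pb sn :
  exec log_prog
    (St [:: base; w; 0; 0; 0; e; g; k; id; c; cnt] [:: de * be; b; x; z] ra pv pb sn)
    (6 * loglen).+1
    (St [:: base; w; 0; 0; loglen; e; g; k; id; c; cnt]
        [:: de * be * 2 ^+ loglen; b; x; z] ra pv pb sn).
Proof.
pose st i := St [:: base; w; 0; 0; i; e; g; k; id; c; cnt]
  [:: de * be * 2 ^+ i; b; x; z] ra pv pb sn.
have st0 : st 0%N = St [:: base; w; 0; 0; 0; e; g; k; id; c; cnt]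
  [:: de * be; b; x; z] ra pv pb sn by rewrite /st expr0 mulr1.
rewrite -st0; apply: exec_while.
  move=> i hi; split; first by have := least_min hi.
  have -> : st i.+1 = St [:: base; w; 0; 0; i + 1; e; g; k; id; c; cnt]
      [:: de * be * 2 ^+ i + de * be * 2 ^+ i; b; x; z] ra pv pb sn.
    by rewrite /st addn1 exprS; congr (State _ (nth _ [:: _, _, _, _ & _])); ring.
  by eapply exec_le; first by rewrite /st; xall.
by rewrite /= negbK dbl_stepsP // mulr_gt0.
Qed.

Lemma invepsP : (1 <= inveps%:R * ep) || (4 <= inveps%:R * de).
Proof.
have [i hi] := natceilP 1 ep_gt0.
by apply: (@leastP (fun e => (1 <= e%:R * ep) || (4 <= e%:R * de)) i); rewrite hi.
Qed.

Lemma exec_inveps base w l g k id c cnt rl ra pv pb sn :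
  exec inveps_prog
    (St [:: base; w; 0; 0; l; 0; g; k; id; c; cnt] rl ra pv pb sn) (2 * inveps).+1
    (St [:: base; w; 0; 0; l; inveps; g; k; id; c; cnt] rl ra pv pb sn).
Proof.
apply: (exec_while (st := fun i => St [:: base; w; 0; 0; l; i; g; k; id; c; cnt] rl ra pv pb sn)).
  move=> i hi; split; first by have := least_min hi; rewrite negb_or.
  by rewrite -[i.+1]addn1; exact: exec_iset.
by rewrite /= negb_and !negbK; exact: invepsP.
Qed.

Lemma ncoinsP : coins_needed <= n%:R * ncoins%:R.
Proof.
have n0 : 0 < n%:R :> R by rewrite ltr0n.
have [i hi] := natceilP coins_needed n0.
by apply: (@leastP (fun k => coins_needed <= n%:R * k%:R) i); rewrite mulrC.
Qed.

Lemma exec_coins base w id c cnt rl ra pv pb sn :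
  exec coins_prog
    (St [:: base; w; 0; 0; loglen; inveps; scale; 0; id; c; cnt] rl ra pv pb sn)
    (2 * ncoins).+1
    (St [:: base; w; 0; 0; loglen; inveps; scale; ncoins; id; c; cnt] rl ra pv pb sn).
Proof.
apply: (exec_while (st := fun i => St [:: base; w; 0; 0; loglen; inveps; scale; i; id; c; cnt]
  rl ra pv pb sn)).
  move=> i hi; split; first by have := least_min hi.
  by rewrite -[i.+1]addn1; exact: exec_iset.
by rewrite /= negbK; exact: ncoinsP.
Qed.

Definition setup_time : nat :=
  (2 * ybits + (18 * ybits + 22) * hbits + 6 * loglen + 2 * inveps + 2 * ncoins + 40)%N.

(** The initial list [l0] is left open because the encoder starts with four natural registers and
    the decoder with five; the first write, to register 15, pads both to one shape. *)
Lemma exec_setup l0 cs r ra pv sn t s' : (y < 2 ^ ybits)%N ->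
  set_nth 0%N l0 15 0%N = [:: n; d; Y; y; m; 0; 0; 0; 0; 0; 0; 0; 0; 0; 0; 0]%N ->
  exec (block cs)
    (St [:: d * hash ybits r y hbits; d * 2 ^ hbits; 0; 0; loglen; inveps; scale; ncoins; 0; 0; 0]
        [:: de * be * 2 ^+ loglen; 2 ^+ ybits; 0; 0] ra pv (drop (hbits * ybits) r) sn) t s' ->
  exec (block (setup ++ cs)) (State (nth 0%N l0) (nth 0 [:: ep; de; be]) ia ra pv r sn)
    (setup_time + t) s'.
Proof.
move=> yY l0E hcs; rewrite /setup /= /block /=; eapply exec_le.
  eapply exec_seq; [xprim | rewrite l0E /=].
  do 3 xone; eapply exec_seq; first exact: exec_power.
  do 2 xone; eapply exec_seq; first exact: exec_hash.
  xone; eapply exec_seq; first exact: exec_log.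
  eapply exec_seq; first exact: exec_inveps.
  xone; eapply exec_seq; first exact: exec_coins.
  xone; exact: hcs.
rewrite /setup_time; lia.
Qed.

Section EncoderExec.
Variables (base w : nat) (ra : nat -> R) (pv pb : seq bool) (x3 x4 : R) (l e : nat).
Variables (g M : nat).

Definition cell_value (j : nat) : R := if (base <= j)%N then ra (j - base) else 0.
Definition cell_count (j : nat) : nat :=
  least (fun c => g%:R * (1 + cell_value j) <= c%:R).
Definition cell_heads (j : nat) : nat := (\sum_(p < M) nth false pv (j * M + p))%N.
Definition cells_sent (j : nat) : seq nat :=
  flatten [seq nseq (cell_count i + cell_heads i) i | i <- iota 0 j].

Hypothesis cell_count_le : forall j, (cell_count j <= 2 * g)%N.

Lemma cell_countP j : g%:R * (1 + cell_value j) <= (cell_count j)%:R.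
Proof.
have [i hi] := natceilP (g%:R * (1 + cell_value j)) (ltr01 : 0 < 1 :> R).
by apply: (@leastP (fun c => g%:R * (1 + cell_value j) <= c%:R) i); rewrite -[leRHS]mulr1.
Qed.

Lemma exec_value j pv' sn :
  exec value_loop
    (St [:: base; w; 0; 0; l; e; g; M; j; 0; 0] [:: x3; x4; cell_value j; 0] ra pv' pb sn)
    (6 * cell_count j).+1
    (St [:: base; w; 0; 0; l; e; g; M; j; cell_count j; 0] [:: x3; x4; cell_value j; 0]
        ra pv' pb (sn ++ nseq (cell_count j) j)).
Proof.
pose st c := St [:: base; w; 0; 0; l; e; g; M; j; c; 0] [:: x3; x4; cell_value j; 0]
        ra pv' pb (sn ++ nseq c j).
have st0 : st 0%N = St [:: base; w; 0; 0; l; e; g; M; j; 0; 0] [:: x3; x4; cell_value j; 0]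
        ra pv' pb sn by rewrite /st cats0.
rewrite -st0; apply: exec_while.
  move=> i hi; split; first by have := least_min hi.
  have -> : st i.+1 = St [:: base; w; 0; 0; l; e; g; M; j; i + 1; 0]
      [:: x3; x4; cell_value j; 0] ra pv' pb (rcons (sn ++ nseq i j) j).
    by rewrite /st -addn1 nseqD catA cats1.
  by eapply exec_le; first by rewrite /st; xall.
by rewrite /= negbK; exact: cell_countP.
Qed.

Lemma exec_noise j sn :
  exec noise_loop
    (St [:: base; w; 0; 0; l; e; g; M; j; 0; 0] [:: x3; x4; cell_value j; 0]
        ra (drop (j * M) pv) pb sn)
    (11 * M).+1
    (St [:: base; w; 0; 0; l; e; g; M; j; M; 0] [:: x3; x4; cell_value j; 0]
        ra (drop (j.+1 * M) pv) pb (sn ++ nseq (cell_heads j) j)).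
Proof.
pose hd c := (\sum_(p < c) nth false pv (j * M + p))%N.
pose st c := St [:: base; w; 0; 0; l; e; g; M; j; c; 0] [:: x3; x4; cell_value j; 0]
        ra (drop (j * M + c) pv) pb (sn ++ nseq (hd c) j).
have st0 : st 0%N = St [:: base; w; 0; 0; l; e; g; M; j; 0; 0] [:: x3; x4; cell_value j; 0]
        ra (drop (j * M) pv) pb sn by rewrite /st /hd big_ord0 cats0 addn0.
have stM : st M = St [:: base; w; 0; 0; l; e; g; M; j; M; 0] [:: x3; x4; cell_value j; 0]
        ra (drop (j.+1 * M) pv) pb (sn ++ nseq (cell_heads j) j).
  by rewrite /st mulSn [(M + _)%N]addnC.
rewrite -st0 -stM; apply: exec_while; last by rewrite stM /= negbK.
move=> i hi; split; first by rewrite /= -ltnNge.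
rewrite /st; eapply exec_le; first (xone; rewrite head_drop behead_drop;
apply: (exec_seq (t1 := 2) (s1 := St [:: base; w; 0; nat_of_bool (nth false pv (j * M + i));
    l; e; g; M; j; i; 0] [:: x3; x4; cell_value j; 0]
        ra (drop (j * M + i).+1 pv) pb (sn ++ nseq (hd i.+1) j)))).
- apply: exec_if; rewrite /= /hd big_ord_recr /=.
  case: (nth false pv (j * M + i)) => /=; last by rewrite addn0; exact: exec_skip.
  by rewrite nseqD catA cats1; exact: exec_send.
- by xone; xone; rewrite addn1 addnS; exact: exec_skip.
- by [].
Qed.

Definition cells_time : nat := ((12 * g + 11 * M + 30) * w).+1.

Lemma exec_cells :
  exec cells_loop
    (St [:: base; w; 0; 0; l; e; g; M; 0; 0; 0] [:: x3; x4; 0; 0] ra pv pb [::])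
    cells_time
    (St [:: base; w; 0; 0; l; e; g; M; w; 0; 0] [:: x3; x4; 0; 0]
        ra (drop (w * M) pv) pb (cells_sent w)).
Proof.
pose st j := St [:: base; w; 0; 0; l; e; g; M; j; 0; 0] [:: x3; x4; 0; 0]
        ra (drop (j * M) pv) pb (cells_sent j).
have st0 : st 0%N = St [:: base; w; 0; 0; l; e; g; M; 0; 0; 0] [:: x3; x4; 0; 0] ra pv pb [::].
  by rewrite /st mul0n drop0.
rewrite -st0; eapply exec_le.
  apply: (exec_while (N := w) (t := (12 * g + 11 * M + 29)%N)); last by rewrite /= negbK.
  move=> j hj; split; first by rewrite /= -ltnNge.
  rewrite /st; eapply exec_le.
    eapply (exec_seq (t1 := 2) (s1 := St [:: base; w; 0; 0; l; e; g; M; j; 0; 0]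
        [:: x3; x4; cell_value j; 0] ra (drop (j * M) pv) pb (cells_sent j))).
      apply: exec_if; rewrite /= /cell_value; case: ifP => _; last exact: exec_skip.
      exact: exec_rset.
    eapply exec_seq; first exact: exec_value.
    xone; eapply exec_seq; first exact: exec_noise.
    xone; xone; xone.
    rewrite addn1 -catA -nseqD.
    have -> : cells_sent j ++ nseq (cell_count j + cell_heads j) j = cells_sent j.+1.
      by rewrite /cells_sent -addn1 iotaD map_cat flatten_cat /= cats0.
    exact: exec_skip.
  by have := cell_count_le j; lia.
by rewrite /cells_time; lia.
Qed.

End EncoderExec.

Section DecoderExec.
Variables (base w : nat) (ms : seq nat) (pv pb : seq bool) (x3 x4 : R) (l e : nat).
Variables (g M : nat).
Hypothesis iaE : ia = nth 0%N ms.
Hypothesis mE : m = size ms.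

Definition estimate (cnt : nat) : R :=
  (cnt%:R - n%:R * (g%:R + M%:R / 2)) / g%:R.

Lemma exec_count j ra :
  exec count_loop
    (St [:: base; w; 0; 0; l; e; g; M; j; 0; 0] [:: x3; x4; 0; 0] ra pv pb [::])
    (7 * m).+1
    (St [:: base; w; 0; 0; l; e; g; M; j; m; count_mem (base + j)%N ms]
        [:: x3; x4; 0; 0] ra pv pb [::]).
Proof.
pose st i := St [:: base; w; 0; 0; l; e; g; M; j; i; count_mem (base + j)%N (take i ms)]
        [:: x3; x4; 0; 0] ra pv pb [::].
have st0 : st 0%N = St [:: base; w; 0; 0; l; e; g; M; j; 0; 0] [:: x3; x4; 0; 0] ra pv pb [::].
  by rewrite /st take0.
have stm : st m = St [:: base; w; 0; 0; l; e; g; M; j; m; count_mem (base + j)%N ms]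
        [:: x3; x4; 0; 0] ra pv pb [::].
  by rewrite /st mE take_size.
rewrite -st0 -stm; apply: exec_while; last by rewrite stm /= negbK.
move=> i hi; split; first by rewrite /= -ltnNge.
rewrite /st; eapply exec_le; first apply: (exec_seq (t1 := 2) (s1 :=
  St [:: base; w; 0; 0; l; e; g; M; j; i; count_mem (base + j)%N (take i.+1 ms)]
        [:: x3; x4; 0; 0] ra pv pb [::])).
- have im : (i < size ms)%N by rewrite -mE.
  apply: exec_if; rewrite /= -eqn_leq (take_nth 0%N im) -cats1 count_cat /= addn0 iaE.
  case: eqP => _; last by rewrite addn0; exact: exec_skip.
  exact: exec_iset.
- by xone; rewrite addn1; exact: exec_skip.
- by [].
Qed.

Definition estimate_time : nat := ((7 * m + 20) * d).+1.

Lemma exec_estimate :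
  exec estimate_loop
    (St [:: base; w; 0; 0; l; e; g; M; 0; 0; 0] [:: x3; x4; 0; 0] (fun=> 0) pv pb [::])
    estimate_time
    (St [:: base; w; 0; 0; l; e; g; M; d; 0; 0] [:: x3; x4; 0; 0]
        (fun j => if (j < d)%N then estimate (count_mem (base + j)%N ms) else 0) pv pb [::]).
Proof.
pose st j0 := St [:: base; w; 0; 0; l; e; g; M; j0; 0; 0] [:: x3; x4; 0; 0]
  (fun j => if (j < j0)%N then estimate (count_mem (base + j)%N ms) else 0) pv pb [::].
rewrite -[exec _ _]/(exec _ (st 0%N)); eapply exec_le.
  apply: (exec_while (N := d) (st := st) (t := (7 * m + 19)%N)); last by rewrite /= negbK.
  move=> j hj; split; first by rewrite /= -ltnNge.
  rewrite /st; eapply exec_le.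
    eapply exec_seq; first exact: exec_count.
    xone; rewrite -/(estimate _).
    xone; xone; xone.
    have -> : upd (fun i => if (i < j)%N then estimate (count_mem (base + i)%N ms) else 0) j
        (estimate (count_mem (base + j)%N ms)) =
        (fun i => if (i < j.+1)%N then estimate (count_mem (base + i)%N ms) else 0).
      apply/funext => i; rewrite /upd ltnS [(i <= j)%N]leq_eqVlt.
      by case: eqP => [->|_] //=.
    by rewrite addn1; exact: exec_skip.
  by lia.
by rewrite /estimate_time; lia.
Qed.

End DecoderExec.
End Programs.

(** * Privacy of the counts *)

Section ShiftedBinomial.
Variables (R : realType) (n M K b : nat).
Hypothesis bK : (b + n * M <= K)%N.
Local Notation N := (n * M)%N.

Lemma shifted_binw_ge0 k : 0 <= shifted_binw R n M b k.
Proof. by rewrite /shifted_binw; case: ifP => // _; exact: binw_ge0. Qed.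

Lemma sum_shifted_binw (A : pred nat) :
  \sum_(k < K.+1 | A k) shifted_binw R n M b k = \sum_(h < N.+1 | A (b + h)%N) binw R N h.
Proof.
rewrite -(big_mkord A (shifted_binw R n M b)).
rewrite (@big_cat_nat _ _ _ b) //=; last by lia.
rewrite [X in X + _]big_nat_cond [X in X + _]big1 ?add0r; last first.
  by move=> k /andP[/andP[_ kb] _]; rewrite /shifted_binw leqNgt kb.
rewrite (@big_cat_nat _ _ _ (b + N).+1 b) //=; [|lia].
rewrite [X in _ + X]big_nat_cond [X in _ + X]big1 ?addr0; last first.
  by move=> k /andP[/andP[kb _] _]; rewrite /shifted_binw; case: ifP => // _;
    rewrite binw_small //; lia.
rewrite -{1}[b]add0n big_addn subSn ?leq_addr // addKn big_mkord.
apply: eq_big => [h|h _]; first by rewrite addnC.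
by rewrite /shifted_binw leq_addl addnK.
Qed.

Lemma sum1_shifted_binw : \sum_(k < K.+1) shifted_binw R n M b k = 1.
Proof. by rewrite (sum_shifted_binw predT) binw_sum. Qed.

Lemma tail_shifted_binw (A : pred nat) (s : R) : 0 <= s <= 1 ->
  (forall k, A k -> s * N%:R < `|k%:R - b%:R - N%:R / 2|) ->
  \sum_(k < K.+1 | A k) shifted_binw R n M b k <= 2 * expR (- (s ^+ 2 * N%:R / 2)).
Proof.
move=> s01 hA; rewrite sum_shifted_binw; apply: le_trans (binw_tail N s01).
rewrite big_mkcond [leRHS]big_mkcond /=; apply: ler_sum => h _.
case: ifP => [/hA|_]; last by case: ifP => // _; exact: binw_ge0.
by rewrite natrD [b%:R + _]addrC addrK => ->.
Qed.

End ShiftedBinomial.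

(** Passes from Chernoff exponents to the power of two that defines [loglen]. *)
Lemma expRN_nat_le (R : realType) (l : nat) : expR (- l%:R) <= (2 ^+ l)^-1 :> R.
Proof.
rewrite expRN lef_pV2 ?posrE ?expR_gt0 ?exprn_gt0 //.
rewrite -[l%:R]mulr1 expRM_natl lerXn2r ?nnegrE ?expR_ge0 //.
by have := @expR_ge1Dx R 1.
Qed.

Section Privacy.
Variables (R : realType) (n d D K : nat) (ep de be : R).
Hypothesis ep_gt0 : 0 < ep.
Hypothesis de01 : 0 < de < 1.
Hypothesis be01 : 0 < be < 1.
Hypothesis n_gt0 : (0 < n)%N.
Hypothesis d_gt0 : (0 < d)%N.

Local Notation l := (loglen d de be).
Local Notation e := (inveps ep de).
Local Notation g := (scale n d).
Local Notation M := (ncoins n d ep de be).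
Local Notation N := (n * M)%N.

Lemma pow_loglen : 64 * d%:R <= de * be * 2 ^+ l.
Proof. by apply: dbl_stepsP; rewrite mulr_gt0 //; [case/andP: de01|case/andP: be01]. Qed.

(** 64 <= 64 d <= delta beta 2^l < 2^l. *)
Lemma loglen_ge7 : (7 <= l)%N.
Proof.
rewrite leqNgt; apply/negP => l6.
have [d0 d1] := andP de01; have [b0 b1] := andP be01.
have := pow_loglen.
have db : de * be < 1 by rewrite mulr_ilt1 // ltW.
have db0 : 0 < de * be by rewrite mulr_gt0.
have p6 : 2 ^+ l <= 64 :> R.
  have -> : 64 = (2 ^ 6)%:R :> R by [].
  by rewrite -natrX ler_nat leq_exp2l.
have d1' : 1 <= d%:R :> R by rewrite ler1n.
have : de * be * 2 ^+ l <= de * be * 64 by rewrite ler_pM2l.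
lra.
Qed.

Lemma inveps_ge1 : (1 <= e)%N.
Proof.
rewrite lt0n; apply/eqP => e0; have := invepsP de ep_gt0.
by rewrite e0 !mul0r ler10 lern0.
Qed.

Lemma inveps_pred : (e%:R - 1) * ep < 1 /\ (e%:R - 1) * de < 4.
Proof.
have e1 := inveps_ge1.
have : (e.-1 < e)%N by rewrite prednK.
move=> /least_min; rewrite negb_or -!ltNge => /andP[].
by rewrite -subn1 natrB.
Qed.

Lemma scale_ge1 : (1 <= g)%N.
Proof. by rewrite /scale addn_gt0 n_gt0. Qed.

(** The relative noise level s. It inverts the quantity squared in [coins_needed], so the choice of
    M amounts to s^2 N >= 40 l. *)
Definition margin : R := (512 * g%:R * (e%:R * l%:R))^-1.
Local Notation s := margin.

Lemma denom_ge1 : 1 <= g%:R * (e%:R * l%:R) :> R.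
Proof.
rewrite -!natrM ler1n !muln_gt0 scale_ge1 inveps_ge1 /=.
by apply: leq_trans loglen_ge7.
Qed.

Lemma margin_gt0 : 0 < s.
Proof. by rewrite invr_gt0 -mulrA mulr_gt0 //; apply: lt_le_trans denom_ge1. Qed.

Lemma marginE : 512 * g%:R * (e%:R * l%:R) * s = 1.
Proof. by rewrite mulfV // gt_eqF // -invr_gt0 margin_gt0. Qed.

Lemma margin_le : s <= 1 / 8.
Proof.
have h := denom_ge1; have h' := marginE; have s0 := margin_gt0.
have : 1 * s <= g%:R * (e%:R * l%:R) * s by rewrite ler_pM2r.
lra.
Qed.

Lemma margin_sqN : 40 * l%:R <= s ^+ 2 * N%:R.
Proof.
have := ncoinsP d ep de be n_gt0; rewrite -natrM /coins_needed => h.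
have s2 : 0 < s ^+ 2 by rewrite exprn_gt0 // margin_gt0.
rewrite -(ler_pM2l s2) in h; apply: le_trans h; rewrite le_eqVlt; apply/orP; left.
by rewrite mulrCA -exprMn [s * _]mulrC marginE expr1n mulr1.
Qed.

(** Two centres differ by at most 2g, hence by at most half the good window. *)
Lemma marginN : 4 * g%:R <= s * N%:R.
Proof.
have s0 := margin_gt0; rewrite -(ler_pM2l s0) [leRHS]mulrA -expr2.
apply: le_trans margin_sqN.
have l1 : 1 <= l%:R :> R by rewrite ler1n; apply: leq_trans loglen_ge7.
have e1 : 1 <= e%:R * l%:R :> R.
  by rewrite -natrM ler1n muln_gt0 inveps_ge1; apply: leq_trans loglen_ge7.
have : s * g%:R * 1 <= s * g%:R * (e%:R * l%:R).
  by rewrite ler_wpM2l // mulr_ge0 // ltW.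
have := marginE; lra.
Qed.

Lemma N_gt0 : (0 < N)%N.
Proof.
rewrite -(ltr0n R).
have s0 := margin_gt0; rewrite -(pmulr_rgt0 _ s0); apply: lt_le_trans marginN.
by rewrite mulr_gt0 // ltr0n scale_ge1.
Qed.

(** The exponent at deviation sN/2 is s^2 N / 8 >= 40 l / 8 = 5 l. *)
Definition tail_bound : R := 2 * ((2 ^+ l)^-1) ^+ 5.

Lemma tail_le : 2 * expR (- ((s / 2) ^+ 2 * N%:R / 2)) <= tail_bound.
Proof.
rewrite ler_pM2l //; apply: (@le_trans _ _ (expR (- (5 * l%:R)))).
  by rewrite ler_expR; have := margin_sqN; rewrite expr_div_n; lra.
rewrite -mulrN expRM_natl lerXn2r ?nnegrE ?expR_ge0 ?invr_ge0 ?exprn_ge0 //.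
exact: expRN_nat_le.
Qed.

(** With m + 1 = 2 e l and privacy loss 1/e, the Chernoff exponent is at most -(2l - 1); the tail
    and quadratic corrections add at most 1 each. The result is at most -l because l >= 7, and
    exp(-l) <= 2^(-l) <= delta/64. *)
Lemma privacy_budget (m : nat) (St Sq : R) :
  m.+1 = (2 * (e * l))%N -> St <= 2 * d%:R * tail_bound -> Sq <= 12 * g%:R ^+ 2 ->
  St + expR (- (m%:R * e%:R^-1)
             + (m.+1%:R * St + 2 * (m.+1%:R * (32 * s)) ^+ 2 * Sq)) <= de / 2.
Proof.
move=> mE hSt hSq; have mER : m.+1%:R = 2 * (e%:R * l%:R) :> R by rewrite mE !natrM.
have [de0 de1] := andP de01; have [be0 be1] := andP be01.
pose z : R := (2 ^+ l)^-1.
have z0 : 0 < z by rewrite invr_gt0 exprn_gt0.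
have p2 : 0 < 2 ^+ l :> R by rewrite exprn_gt0.
have e1 : 1 <= e%:R :> R by rewrite ler1n inveps_ge1.
have dz : 64 * (d%:R * z) <= de.
  have := pow_loglen; rewrite -(ler_pM2r z0).
  have -> : de * be * 2 ^+ l * z = de * be by rewrite /z mulfK // gt_eqF.
  have : de * be <= de * 1 by rewrite ler_pM2l // ltW.
  lra.
have d1 : 1 <= d%:R :> R by rewrite ler1n.
have zd : z <= d%:R * z by rewrite -[leLHS]mul1r ler_pM2r.
have lz : l%:R * z <= 1.
  by rewrite /z ler_pdivrMr // mul1r -natrX ler_nat ltnW // ltn_expl.
have z1 : z <= 1 by lra.
have zk k : z ^+ k <= 1 by rewrite exprn_ile1 // ltW.
have zk0 k : 0 <= z ^+ k by rewrite exprn_ge0 // ltW.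
have dz0 : 0 <= d%:R * z by rewrite mulr_ge0 // ltW.
have hSt' : St <= 4 * (d%:R * z) * z ^+ 4.
  apply: (le_trans hSt); rewrite /tail_bound -/z le_eqVlt; apply/orP; left.
  by apply/eqP; ring.
have St4 : St <= de / 4.
  apply: (le_trans hSt'); apply: (@le_trans _ _ (4 * (d%:R * z) * 1)).
    by rewrite ler_wpM2l // mulr_ge0.
  lra.
have mSt : m.+1%:R * St <= 1.
  rewrite mER; apply: (@le_trans _ _ (2 * (e%:R * l%:R) * (4 * (d%:R * z) * z ^+ 4))).
    by rewrite ler_wpM2l // !mulr_ge0.
  have -> : 2 * (e%:R * l%:R) * (4 * (d%:R * z) * z ^+ 4) =
    8 * (e%:R * (d%:R * z)) * (l%:R * z) * z ^+ 3 by ring.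
  (* The cap on e acts here: the moment order m multiplies the tails, and e can be absorbed by 64 d
     2^(-l) <= delta only because e delta is bounded. Without it l would have to contain
     log(1/eps). *)
  have ed : e%:R * de <= 5.
    have [_] := inveps_pred; rewrite mulrBl mul1r; lra.
  have edz : e%:R * (d%:R * z) <= 5 / 64.
    have : e%:R * (64 * (d%:R * z)) <= e%:R * de by rewrite ler_wpM2l.
    lra.
  have edz0 : 0 <= e%:R * (d%:R * z) by rewrite mulr_ge0.
  have lz0 : 0 <= l%:R * z by rewrite mulr_ge0 // ltW.
  apply: (@le_trans _ _ (8 * (e%:R * (d%:R * z)) * (l%:R * z) * 1)).
    by rewrite ler_wpM2l // mulr_ge0 // mulr_ge0.
  rewrite mulr1; apply: (@le_trans _ _ (8 * (e%:R * (d%:R * z)) * 1)).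
    by rewrite ler_wpM2l // mulr_ge0.
  lra.
(* The constant 512 in s is chosen for this: the left side becomes 2 * 64^2 * 12 / 512^2 = 3/8. *)
have uS : 2 * (m.+1%:R * (32 * s)) ^+ 2 * Sq <= 1.
  rewrite mER; apply: (@le_trans _ _ (2 * (2 * (e%:R * l%:R) * (32 * s)) ^+ 2 * (12 * g%:R ^+ 2))).
    by rewrite ler_wpM2l // mulr_ge0 // sqr_ge0.
  have -> : 2 * (2 * (e%:R * l%:R) * (32 * s)) ^+ 2 * (12 * g%:R ^+ 2) =
      (3 / 8) * (512 * g%:R * (e%:R * l%:R) * s) ^+ 2 by field.
  by rewrite marginE expr1n mulr1; lra.
have mexp : 2 * l%:R - 1 <= m%:R * e%:R^-1 :> R.
  have -> : m%:R * e%:R^-1 = 2 * l%:R - e%:R^-1 :> R.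
    have -> : m%:R = 2 * (e%:R * l%:R) - 1 :> R by rewrite -mER -[m.+1%:R]natr1 addrK.
    by field; rewrite gt_eqF //; lra.
  by rewrite lerD2l lerN2 invf_le1 //; lra.
have l7 : 7 <= l%:R :> R by rewrite (ler_nat R 7); exact: loglen_ge7.
have : expR (- (m%:R * e%:R^-1) + (m.+1%:R * St + 2 * (m.+1%:R * (32 * s)) ^+ 2 * Sq))
    <= expR (- l%:R).
  by rewrite ler_expR; lra.
have := expRN_nat_le R l; rewrite -/z; lra.
Qed.

Section Core.
Variables a a' : 'I_D -> nat.
Hypothesis aK : forall j, (a j + N <= K)%N.
Hypothesis aK' : forall j, (a' j + N <= K)%N.
Let gap j : R := `|(a j)%:R - (a' j)%:R|.
Hypothesis gap_le : forall j, gap j <= 2 * g%:R.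
Hypothesis gap_sq : \sum_j gap j ^+ 2 <= 12 * g%:R ^+ 2.
Hypothesis gap_count : (\sum_j (a j != a' j) <= 2 * d)%N.

Lemma core_dp (F : {ffun 'I_D -> 'I_K.+1} -> R) :
  (forall w, 0 <= F w <= 1) ->
  \sum_(w : {ffun 'I_D -> 'I_K.+1}) (\prod_j shifted_binw R n M (a j) (w j)) * F w <=
  expR (e%:R^-1) * (\sum_(w : {ffun 'I_D -> 'I_K.+1})
       (\prod_j shifted_binw R n M (a' j) (w j)) * F w) + de / 2.
Proof.
move=> F01.
have s0 := margin_gt0; have s18 := margin_le; have sN := marginN.
have N0 : 0 < N%:R :> R by rewrite ltr0n N_gt0.
(* Cells with equal offsets are declared good everywhere. Tails are thus charged to at most 2d cells
   instead of all d 2^k, which keeps log n out of the error. *)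
pose good (j : 'I_D) (k : 'I_K.+1) :=
  (a j == a' j) || (`|k%:R - (a j)%:R - N%:R / 2| <= s * N%:R).
pose u (j : 'I_D) : R := 32 * s * gap j.
pose tau (j : 'I_D) : R := (a j != a' j)%:R * tail_bound.
have gap0 j : 0 <= gap j by exact: normr_ge0.
have u0 j : 0 <= u j by rewrite !mulr_ge0 // ltW.
have tb0 : 0 <= tail_bound by rewrite mulr_ge0 // exprn_ge0 // invr_ge0 exprn_ge0.
have sgap j : s * gap j <= s * (2 * g%:R) by rewrite ler_pM2l.
have g0 : 0 < g%:R :> R by rewrite ltr0n scale_ge1.
have l1 : 1 <= l%:R :> R by rewrite ler1n; apply: leq_trans loglen_ge7.
have e1 : 1 <= e%:R :> R by rewrite ler1n inveps_ge1.
have el1 : 1 <= e%:R * l%:R :> R by rewrite -natrM ler1n muln_gt0 inveps_ge1 /=; move: l1; rewrite ler1n.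
have sg : s * g%:R <= 1 / 512.
  have : s * g%:R * 1 <= s * g%:R * (e%:R * l%:R) by rewrite ler_pM2l // mulr_gt0.
  have := marginE; lra.
pose m := (2 * (e * l)).-1.
have mE : m.+1 = (2 * (e * l))%N.
  by rewrite /m prednK // !muln_gt0 inveps_ge1 /=; apply: leq_trans loglen_ge7.
have mER : m.+1%:R = 2 * (e%:R * l%:R) :> R by rewrite mE !natrM.
have mu j : m.+1%:R * u j <= 1 / 2.
  have : e%:R * l%:R * (s * gap j) <= e%:R * l%:R * (s * (2 * g%:R)).
    by rewrite ler_wpM2l // mulr_ge0.
  have := marginE; rewrite mER /u; lra.
have near_good (j : 'I_D) (k : 'I_K.+1) : good j k ->
    `|shifted_binw R n M (a j) k - shifted_binw R n M (a' j) k|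
      <= u j * shifted_binw R n M (a' j) k.
  case/orP => [/eqP aj|hk].
    by rewrite /u /gap aj !subrr !normr0 mulr0 mul0r.
  have hk1 := hk; rewrite ler_norml in hk1; have [hk2 hk3] := andP hk1.
  have hg := gap_le j; rewrite /gap ler_norml in hg; have [hg1 hg2] := andP hg.
  have sN8 : s * N%:R <= 1 / 8 * N%:R by rewrite ler_pM2r.
  have ak : (a j <= k)%N by rewrite -(ler_nat R); lra.
  have ak' : (a' j <= k)%N by rewrite -(ler_nat R); lra.
  rewrite /shifted_binw ak ak'.
  have gE : `|(k - a j)%N%:R - (k - a' j)%N%:R| = gap j :> R.
    rewrite !natrB // /gap distrC; congr `|_|; ring.
  rewrite /u -gE; apply: binw_near => //.
  - exact: N_gt0.
  - exact: ltW.
  - by rewrite natrB //; apply: (le_trans hk); rewrite ler_pM2r //; lra.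
  - by rewrite natrB // ler_norml; apply/andP; split; lra.
  - by rewrite gE; have := sgap j; lra.
have s2 : 0 <= s / 2 <= 1 by apply/andP; split; lra.
have bad_f j : \sum_(k | ~~ good j k) shifted_binw R n M (a j) k <= tau j.
  rewrite /tau /good; case: eqP => aj /=.
    by rewrite big_pred0 ?mul0r.
  rewrite mul1r; apply: le_trans tail_le.
  apply: (tail_shifted_binw (A := fun k : nat =>
    ~~ (`|k%:R - (a j)%:R - N%:R / 2| <= s * N%:R)) (aK j) s2) => k.
  by rewrite -ltNge; apply: le_lt_trans; rewrite ler_pM2r //; lra.
have bad_q j : \sum_(k | ~~ good j k) shifted_binw R n M (a' j) k <= tau j.
  rewrite /tau /good; case: eqP => aj /=.
    by rewrite big_pred0 ?mul0r.
  rewrite mul1r; apply: le_trans tail_le.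
  apply: (tail_shifted_binw (A := fun k : nat =>
    ~~ (`|k%:R - (a j)%:R - N%:R / 2| <= s * N%:R)) (aK' j) s2) => k.
  rewrite -ltNge => hk.
  (* The window is centred at [a], so for [a'] the deviation is only sN - 2g, which is still at
     least sN/2. *)
  have := ler_normD (k%:R - (a' j)%:R - N%:R / 2 : R) ((a' j)%:R - (a j)%:R : R).
  have -> : k%:R - (a' j)%:R - N%:R / 2 + ((a' j)%:R - (a j)%:R) =
    k%:R - (a j)%:R - N%:R / 2 :> R by ring.
  rewrite [`|(a' j)%:R - _|]distrC -/(gap j); have := gap_le j; lra.
pose f (b : 'I_D -> nat) (j : 'I_D) (k : 'I_K.+1) := shifted_binw R n M (b j) k.
have f0 b j k : 0 <= f b j k by exact: shifted_binw_ge0.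
have f1 b : (forall j, (b j + N <= K)%N) -> forall j, \sum_k f b j k = 1.
  by move=> bK j; exact: sum1_shifted_binw.
have := @product_dp R 'I_D 'I_K.+1 (f a) (f a') good u tau (f0 a) (f0 a') (f1 a aK) (f1 a' aK')
  u0 near_good bad_f bad_q m e%:R^-1 F mu F01.
move/le_trans; apply.
rewrite -addrA lerD2l.
have -> : \sum_j (m.+1%:R * tau j + 2 * (m.+1%:R * u j) ^+ 2) =
    m.+1%:R * (\sum_j tau j) + 2 * (m.+1%:R * (32 * s)) ^+ 2 * \sum_j gap j ^+ 2.
  rewrite big_split /= -mulr_sumr; congr (_ + _).
  by rewrite mulr_sumr; apply: eq_bigr => j _; rewrite /u; ring.
apply: privacy_budget => //.
by rewrite /tau -mulr_suml ler_wpM2r // -natr_sum -natrM ler_nat.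
Qed.

End Core.
End Privacy.

(** * The protocol *)

Lemma window_sum (V : nmodType) (D d base : nat) (F : nat -> V) : (base + d <= D)%N ->
  \sum_(j < D | (base <= j < base + d)%N) F (j - base)%N = \sum_(j < d) F j.
Proof.
move=> hD; rewrite -(big_mkord (fun j => (base <= j < base + d)%N) (fun j => F (j - base)%N)).
rewrite (@big_cat_nat _ _ _ base) //=; last by lia.
rewrite (@big_cat_nat _ _ _ (base + d)%N base) //=; last by lia.
rewrite [X in X + _]big_nat_cond [X in X + _]big1 ?add0r; last by move=> j hj; exfalso; lia.
rewrite [X in _ + X]big_nat_cond [X in _ + X]big1 ?addr0; last by move=> j hj; exfalso; lia.
rewrite big_nat_cond (eq_bigl (fun j => (base <= j < base + d)%N)); last by move=> j; lia.
rewrite -big_nat -{1}[base]add0n big_addn addKn big_mkord.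
by apply: eq_bigr => j _; rewrite addnK.
Qed.

Lemma count_flatten_nseq (F : nat -> nat) (s : seq nat) x : uniq s ->
  count_mem x (flatten [seq nseq (F i) i | i <- s]) = if x \in s then F x else 0%N.
Proof.
elim: s => [|i s IH] //= /andP[is_ us]; rewrite count_cat count_nseq IH // inE /=.
case: (eqVneq x i) => [->|xi] /=; last first.
  by rewrite mul0n in_cons (negPf xi).
by rewrite mul1n (negPf is_) addn0 mem_head.
Qed.

Lemma perm_eq_countP (s t : seq nat) :
  (forall x, count_mem x s = count_mem x t) -> perm_eq s t.
Proof. by move=> h; apply/allP => x _; rewrite /= h. Qed.

Section RowCells.
Variables (R : realType) (d : nat) (x : 'rV[R]_d).

Lemma row_cells_ord (j : 'I_d) : row_cells x j = x ord0 j.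
Proof. by rewrite /row_cells valK. Qed.

Lemma row_cells_out j : (d <= j)%N -> row_cells x j = 0.
Proof. by move=> dj; rewrite /row_cells insubF // ltnNge dj. Qed.

Lemma l2norm_sq : l2norm x ^+ 2 = \sum_(j < d) x ord0 j ^+ 2.
Proof. by rewrite sqr_sqrtr // sumr_ge0 // => j _; rewrite sqr_ge0. Qed.

Lemma sum_sq_le1 : l2norm x <= 1 -> \sum_(j < d) x ord0 j ^+ 2 <= 1.
Proof. by move=> h; rewrite -l2norm_sq expr_le1 // sqrtr_ge0. Qed.

Lemma row_cells_le1 j : l2norm x <= 1 -> `|row_cells x j| <= 1.
Proof.
move=> /sum_sq_le1 h; case: (ltnP j d) => jd; last by rewrite row_cells_out // normr0.
rewrite (row_cells_ord (Ordinal jd)) -(@expr_le1 _ 2) //.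
rewrite real_normK ?num_real //; apply: le_trans h.
by rewrite (bigD1 (Ordinal jd)) //= lerDl sumr_ge0 // => i _; rewrite sqr_ge0.
Qed.

End RowCells.

Section CellCount.
Variables (R : realType) (base : nat) (ra : nat -> R) (g : nat).
Hypothesis ra_le1 : forall j, `|ra j| <= 1.
Local Notation v := (cell_value base ra).
Local Notation cc := (cell_count base ra g).

Lemma cell_value_le1 j : `|v j| <= 1.
Proof. by rewrite /cell_value; case: ifP => // _; rewrite normr0. Qed.

Lemma cell_count_bounds j : g%:R * (1 + v j) <= (cc j)%:R < g%:R * (1 + v j) + 1.
Proof.
rewrite cell_countP /=.
have := cell_value_le1 j; rewrite ler_norml => /andP[v1 v2].
have ge0 : 0 <= g%:R * (1 + v j) by rewrite mulr_ge0 //; lra.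
case E : (cc j) => [|k].
  by rewrite ltr_wpDl.
have : (k < cc j)%N by rewrite E.
by move=> /least_min; rewrite -ltNge -[k.+1%:R]natr1 ltrD2r.
Qed.

Lemma cell_count_le2 j : (cc j <= 2 * g)%N.
Proof.
apply: least_le; have := cell_value_le1 j; rewrite ler_norml => /andP[v1 v2].
by rewrite mulnC natrM ler_wpM2l //; lra.
Qed.

(** As g is an integer no rounding occurs outside the window of the user, so there the count does
    not depend on the input. *)
Lemma cell_count0 j : v j = 0 -> cc j = g.
Proof.
move=> v0; apply/eqP; rewrite eqn_leq; apply/andP; split.
  by apply: least_le; rewrite v0 addr0 mulr1.
by rewrite -(ler_nat R); have := cell_countP base ra g j; rewrite v0 addr0 mulr1.
Qed.

End CellCount.

Section Protocol.
Variables (R : realType) (P : params R).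

Definition Pybits := ybits R (nbuckets P).
Definition Phbits := hbits (nusers P) (beta P).
Definition Pscale := scale (nusers P) (vdim P).
Definition Pcoins := ncoins (nusers P) (vdim P) (eps P) (delta P) (beta P).
Definition Pcells := (vdim P * 2 ^ Phbits)%N.
Definition Pmsgs := (nusers P * (Pcells * (2 * Pscale + Pcoins)))%N.
(** Besides the running times, the coin totals are included, since this number also fixes how many
    coins each run receives. *)
Definition Ptime : nat :=
  (setup_time (nusers P) (vdim P) (nbuckets P) (eps P) (delta P) (beta P)
   + cells_time Pcells Pscale Pcoins + estimate_time (vdim P) Pmsgs
   + Pcells * Pcoins + Phbits * Pybits + 3)%N.
Definition Pbase (r : seq bool) (y : nat) : nat := (vdim P * hash Pybits r y Phbits)%N.

Lemma coins_time : (Pcells * Pcoins <= Ptime)%N.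
Proof. by rewrite /Ptime; lia. Qed.

Lemma hash_time : (Phbits * Pybits <= Ptime)%N.
Proof. by rewrite /Ptime; lia. Qed.

Local Notation n := (nusers P).
Local Notation d := (vdim P).
Local Notation T := Ptime.

Hypothesis n_gt0 : (0 < n)%N.
Hypothesis d_gt0 : (0 < d)%N.
Hypothesis eps_gt0 : 0 < eps P.
Hypothesis delta01 : 0 < delta P < 1.
Hypothesis beta01 : 0 < beta P < 1.
Hypothesis big_n : 1 < eps P * n%:R.

Let delta_gt0 : 0 < delta P. Proof. by case/andP: delta01. Qed.
Let beta_gt0 : 0 < beta P. Proof. by case/andP: beta01. Qed.

Lemma bucket_lt (y : 'I_(nbuckets P)) : (y < 2 ^ Pybits)%N.
Proof.
apply: leq_trans (ltn_ord y) _.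
by have := @dbl_stepsP R 1 (nbuckets P)%:R ltr01; rewrite mul1r -natrX ler_nat.
Qed.

Lemma base_le r y : (Pbase r y + d <= Pcells)%N.
Proof. by rewrite /Pbase /Pcells -mulnSr leq_mul2l hash_lt orbT. Qed.

Section Encoder.
Variables (r c : T.-tuple bool) (u : user_input P).
Hypothesis u_valid : valid_input u.

Lemma exec_encoder : exists2 s',
  exec encoder (enc_init r c u)
    (setup_time n d (nbuckets P) (eps P) (delta P) (beta P)
      + cells_time Pcells Pscale Pcoins + 3)%N s' &
  sent s' = cells_sent (Pbase r u.1) (row_cells u.2) c Pscale Pcoins Pcells.
Proof.
eexists.
  eapply exec_le.
    apply: exec_guard; first by rewrite /= -ltNge.
    apply: (@exec_setup R n d (nbuckets P) u.1 0 (eps P) (delta P) (beta P)) => //.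
      exact: bucket_lt.
    eapply exec_seq; last exact: exec_skip.
    apply: exec_cells => //.
    by move=> j; apply: cell_count_le2 => i; exact: row_cells_le1.
  by rewrite -/Phbits -/Pcells -/Pscale -/Pcoins; lia.
by [].
Qed.

Lemma encoder_halts : halts_within T encoder (enc_init r c u).
Proof.
have [s' hs _] := exec_encoder.
by rewrite /halts_within (run_exec hs) // /Ptime; lia.
Qed.

Lemma encoder_outputE : enc_output T encoder r c u =
  cells_sent (Pbase r u.1) (row_cells u.2) c Pscale Pcoins Pcells.
Proof.
have [s' hs <-] := exec_encoder.
by rewrite /enc_output (run_exec hs) // /Ptime; lia.
Qed.

End Encoder.

Section Messages.
Variables (r : T.-tuple bool) (X : dataset P).
Hypothesis X_valid : valid_dataset X.

Definition offset (j : nat) : nat :=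
  (\sum_(i < n) cell_count (Pbase r (X i).1) (row_cells (X i).2) Pscale j)%N.

Lemma offset_le j : (offset j <= n * (2 * Pscale))%N.
Proof.
rewrite -[X in (_ <= X * _)%N]card_ord -sum_nat_const leq_sum // => i _.
by apply: cell_count_le2 => k; apply: row_cells_le1; exact: X_valid.
Qed.

Lemma count_messages c x : count_mem x (all_messages encoder r X c) =
  if (x < Pcells)%N then (offset x + heads Pcoins c x)%N else 0%N.
Proof.
rewrite /all_messages count_flatten sumnE 2!big_map big_enum /=.
transitivity (\sum_(i < n) (if (x < Pcells)%N then
    cell_count (Pbase r (X i).1) (row_cells (X i).2) Pscale x + cell_heads (c i) Pcoins x
    else 0))%N.
  apply: eq_bigr => i _; rewrite encoder_outputE; last exact: X_valid.
  by rewrite count_flatten_nseq ?iota_uniq // mem_iota.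
case: ifP => _; last by rewrite big1.
by rewrite big_split.
Qed.

Definition count_bound : nat := (n * (2 * Pscale) + n * Pcoins)%N.

Lemma offset_count_bound (j : 'I_Pcells) : (offset j + n * Pcoins <= count_bound)%N.
Proof. by rewrite leq_add2r offset_le. Qed.

(** A canonical list with the given counts. The shuffler erases its order, so the view becomes
    randomized post-processing of the counts. *)
Definition messages_of (w : {ffun 'I_Pcells -> 'I_count_bound.+1}) : seq nat :=
  flatten [seq nseq (if insub j is Some i then w i else 0%N) j | j <- iota 0 Pcells].

Lemma perm_messages c : perm_eq (all_messages encoder r X c)
  (messages_of (counts Pcoins count_bound (fun j : 'I_Pcells => offset j) c)).
Proof.
apply: perm_eq_countP => x; rewrite count_messages /messages_of.
rewrite (count_flatten_nseq (fun j => if insub j is Some i then _ else 0%N)) ?iota_uniq //.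
rewrite mem_iota /= add0n; case: ltnP => // xC.
rewrite insubT /= ffunE inordK // ltnS.
apply: leq_trans (offset_count_bound (Ordinal xC)).
by rewrite leq_add2l heads_le.
Qed.

Lemma size_messages c : (size (all_messages encoder r X c) <= Pmsgs)%N.
Proof.
rewrite (perm_size (perm_messages c)) /messages_of size_flatten sumnE 2!big_map.
have -> : iota 0 Pcells = index_iota 0 Pcells by rewrite /index_iota subn0.
rewrite big_mkord.
apply: (@leq_trans (\sum_(j < Pcells) n * (2 * Pscale + Pcoins))%N); last first.
  by rewrite sum_nat_const card_ord /Pmsgs; lia.
apply: leq_sum => j _; rewrite size_nseq valK.
apply: leq_trans (leq_ord _) _.
by rewrite /count_bound mulnDr.
Qed.

End Messages.
End Protocol.

(** * Sensitivity of the counts to one user *)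

Section CellWindow.
Variables (R : realType) (D d base : nat) (x : 'rV[R]_d).
Hypothesis baseD : (base + d <= D)%N.
Local Notation v := (cell_value base (row_cells x)).
Local Notation window j := (base <= j < base + d)%N.

Lemma cell_value_out j : ~~ window j -> v j = 0.
Proof.
rewrite /cell_value; case: ifP => //= bj hj; apply: row_cells_out; lia.
Qed.

Lemma sum_window : (\sum_(j < D) window j)%N = d.
Proof.
have := window_sum (fun=> 1%N) baseD; rewrite [X in _ = X]sum1_card card_ord big_mkcond => h; rewrite -[RHS]h.
by apply: eq_bigr => j _; case: ifP.
Qed.

Lemma sum_cell_value_sq : \sum_(j < D) v j ^+ 2 = \sum_(j < d) x ord0 j ^+ 2.
Proof.
under [RHS]eq_bigr do rewrite -row_cells_ord.
rewrite -(window_sum (fun j => row_cells x j ^+ 2) baseD) [RHS]big_mkcond.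
apply: eq_bigr => j _; case: ifP => [/andP[bj _]|/negbT hj].
  by rewrite /cell_value bj.
by rewrite cell_value_out // expr0n.
Qed.

End CellWindow.

Section CellGap.
Variables (R : realType) (D d base base' : nat) (x x' : 'rV[R]_d) (g : nat).
Hypothesis baseD : (base + d <= D)%N.
Hypothesis baseD' : (base' + d <= D)%N.
Hypothesis x_le1 : l2norm x <= 1.
Hypothesis x_le1' : l2norm x' <= 1.
Hypothesis dg : (d <= g)%N.
Local Notation cc := (cell_count base (row_cells x) g).
Local Notation cc' := (cell_count base' (row_cells x') g).
Let inw j := (base <= j < base + d)%N.
Let inw' j := (base' <= j < base' + d)%N.

Lemma cell_count_outside j : ~~ inw j -> ~~ inw' j -> cc j = cc' j.
Proof.
move=> h h'; rewrite !cell_count0 //; exact: cell_value_out.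
Qed.

Lemma cell_gap_le j : `|(cc j)%:R - (cc' j)%:R| <= 2 * g%:R :> R.
Proof.
have h : (cc j <= 2 * g)%N by apply: cell_count_le2 => i; exact: row_cells_le1.
have h' : (cc' j <= 2 * g)%N by apply: cell_count_le2 => i; exact: row_cells_le1.
rewrite -!(ler_nat R) natrM in h h'.
have := ler0n R (cc j); have := ler0n R (cc' j).
by rewrite ler_norml => ? ?; apply/andP; split; lra.
Qed.

Lemma cell_gap_count : (\sum_(j < D) (cc j != cc' j) <= 2 * d)%N.
Proof.
apply: (@leq_trans (\sum_(j < D) (inw j + inw' j))%N).
  apply: leq_sum => j _; case: (boolP (inw j)) => h; first by case: (cc j != _).
  case: (boolP (inw' j)) => h'; first by case: (cc j != _).
  by rewrite cell_count_outside // eqxx.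
by rewrite big_split /= !sum_window // mul2n addnn.
Qed.

(** In each affected cell the gap is at most g|v| + g|v'| + 1, whose square is at most 3 times the
    sum of squares. Summing gives 3 (g^2 + g^2 + 2d), and d <= g <= g^2. *)
Lemma cell_gap_sq : \sum_(j < D) `|(cc j)%:R - (cc' j)%:R| ^+ 2 <= 12 * g%:R ^+ 2 :> R.
Proof.
pose v := cell_value base (row_cells x); pose v' := cell_value base' (row_cells x').
apply: (@le_trans _ _ (\sum_(j < D) 3 * (g%:R ^+ 2 * v j ^+ 2 + g%:R ^+ 2 * v' j ^+ 2
    + ((inw j)%:R + (inw' j)%:R)))).
  apply: ler_sum => j _; rewrite real_normK ?num_real //.
  case: (boolP (inw j || inw' j)) => [h|]; last first.
    rewrite negb_or => /andP[h h']; rewrite cell_count_outside // subrr expr0n /=.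
    apply: mulr_ge0 => //; apply: addr_ge0; last by apply: addr_ge0; exact: ler0n.
    by apply: addr_ge0; apply: mulr_ge0; exact: sqr_ge0.
  have ge1 : 1 <= (inw j)%:R + (inw' j)%:R :> R.
    by rewrite -natrD ler1n; case/orP: h => ->; rewrite ?addn1.
  have h1 i : `|row_cells x i| <= 1 by exact: row_cells_le1.
  have h1' i : `|row_cells x' i| <= 1 by exact: row_cells_le1.
  have /andP[b1 b2] := cell_count_bounds base g h1 j.
  have /andP[b1' b2'] := cell_count_bounds base' g h1' j.
  rewrite -/(v j) -/(v' j) in b1 b2 b1' b2'.
  set q := (cc j)%:R - (cc' j)%:R; set p := g%:R * v j; set p' := g%:R * v' j.
  have q1 : `|q| <= `|p| + `|p'| + 1.
    rewrite mulrDr mulr1 -/p in b1 b2; rewrite mulrDr mulr1 -/p' in b1' b2'.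
    have n1 := ler_norm p; have n1' := ler_norm p'.
    have n2 := ler_norm (- p); have n2' := ler_norm (- p'); rewrite !normrN in n2 n2'.
    by rewrite ler_norml /q; apply/andP; split; lra.
  apply: (@le_trans _ _ ((`|p| + `|p'| + 1) ^+ 2)).
    by rewrite -(real_normK (num_real q)) lerXn2r ?nnegrE ?addr_ge0.
  have -> : g%:R ^+ 2 * v j ^+ 2 = `|p| ^+ 2 by rewrite real_normK ?num_real // exprMn.
  have -> : g%:R ^+ 2 * v' j ^+ 2 = `|p'| ^+ 2 by rewrite real_normK ?num_real // exprMn.
  have := sqr_ge0 (`|p| - `|p'|); have := sqr_ge0 (`|p| - 1); have := sqr_ge0 (`|p'| - 1).
  by rewrite !expr2; lra.
rewrite -mulr_sumr !big_split /= -!mulr_sumr.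
rewrite !sum_cell_value_sq // -!natr_sum !sum_window //.
have s1 := sum_sq_le1 x_le1; have s1' := sum_sq_le1 x_le1'.
have G0 : 0 <= g%:R ^+ 2 :> R by exact: sqr_ge0.
have gd : d%:R <= g%:R ^+ 2 :> R.
  rewrite -natrX ler_nat (leq_trans dg) //; case: (g) => // k.
  by rewrite expnS expn1 leq_pmulr.
have : g%:R ^+ 2 * \sum_(j < d) x ord0 j ^+ 2 <= g%:R ^+ 2 * 1 by rewrite ler_wpM2l.
have : g%:R ^+ 2 * \sum_(j < d) x' ord0 j ^+ 2 <= g%:R ^+ 2 * 1 by rewrite ler_wpM2l.
lra.
Qed.

End CellGap.

Section ProtocolPrivacy.
Variables (R : realType) (P : params R).
Local Notation n := (nusers P).
Local Notation d := (vdim P).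
Local Notation T := (Ptime P).

Hypothesis n_gt0 : (0 < n)%N.
Hypothesis d_gt0 : (0 < d)%N.
Hypothesis eps_gt0 : 0 < eps P.
Hypothesis delta01 : 0 < delta P < 1.
Hypothesis beta01 : 0 < beta P < 1.
Hypothesis big_n : 1 < eps P * n%:R.

Lemma coins_gt0 : (0 < Pcoins P)%N.
Proof.
have := N_gt0 eps_gt0 delta01 beta01 n_gt0 d_gt0.
by rewrite muln_gt0 => /andP[].
Qed.

Lemma view_meanE (r : T.-tuple bool) (X : dataset P) (f : seq nat -> R) : valid_dataset X ->
  view_mean encoder r X f =
  \sum_(w : {ffun 'I_(Pcells P) -> 'I_(count_bound P).+1})
    (\prod_(j < Pcells P) shifted_binw R n (Pcoins P) (offset r X j) (w j)) * shuffle_mean (messages_of w) f.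
Proof.
move=> vX.
rewrite -(counts_pushforward coins_gt0 (coins_time P) (fun j => offset_count_bound r vX j)).
by apply: eq_unif_mean => c; apply: shuffle_mean_perm; apply: perm_messages.
Qed.

Lemma offset_neighbors (r : T.-tuple bool) (X X' : dataset P) i0 j :
  (forall i, i != i0 -> X i = X' i) ->
  exists k, offset r X j =
      (k + cell_count (Pbase P r (X i0).1) (row_cells (X i0).2) (Pscale P) j)%N /\
    offset r X' j =
      (k + cell_count (Pbase P r (X' i0).1) (row_cells (X' i0).2) (Pscale P) j)%N.
Proof.
move=> nb; exists (\sum_(i < n | i != i0)
  cell_count (Pbase P r (X i).1) (row_cells (X i).2) (Pscale P) j)%N.
rewrite /offset !(bigD1 i0 (P := predT)) //= addnC; split => //; rewrite addnC.
by congr (_ + _)%N; apply: eq_bigr => i /nb ->.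
Qed.

(** For fixed public coins the hash only moves the windows, so the bound on the counts applies to
    every outcome of these coins. It gives loss 1/e and delta/2; the other half of delta serves the
    capped case. *)
Lemma protocol_private : shuffle_dp P T encoder.
Proof.
move=> r X X' vX vX' [i0 nb] S.
set f := fun ms => (S ms)%:R.
have f01 ms : 0 <= f ms <= 1 by rewrite /f; case: (S ms); rewrite ?ler01 lexx.
have gapE j : `|(offset r X j)%:R - (offset r X' j)%:R| =
    `|(cell_count (Pbase P r (X i0).1) (row_cells (X i0).2) (Pscale P) j)%:R -
      (cell_count (Pbase P r (X' i0).1) (row_cells (X' i0).2) (Pscale P) j)%:R| :> R.
  have [k [-> ->]] := offset_neighbors r j nb.
  by rewrite !natrD; congr `|_|; ring.
have dg : (d <= Pscale P)%N by rewrite /Pscale /scale leq_addl.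
have key : view_mean encoder r X f <=
    expR ((inveps (eps P) (delta P))%:R^-1) * view_mean encoder r X' f + delta P / 2.
  rewrite !view_meanE //; apply: core_dp => //.
  - by move=> j; exact: offset_count_bound.
  - by move=> j; exact: offset_count_bound.
  - by move=> j /=; rewrite gapE; apply: cell_gap_le; [exact: vX | exact: vX'].
  - under eq_bigr do rewrite gapE.
    by apply: cell_gap_sq => //; [exact: base_le | exact: base_le | exact: vX | exact: vX'].
  - apply: leq_trans (cell_gap_count (X i0).2 (X' i0).2 (Pscale P)
      (base_le P r (X i0).1) (base_le P r (X' i0).1)).
    apply: leq_sum => j _; have [k [-> ->]] := offset_neighbors r j nb.
    by rewrite eqn_add2l.
  - by move=> w; exact: shuffle_mean01.
have cards : (0 < #|{: {ffun 'I_n -> T.-tuple bool}}|)%N.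
  by apply/card_gt0P; exists [ffun => [tuple false | _ < T]].
have V0 : 0 <= view_mean encoder r X' f.
  by apply: unif_mean_ge0 => c; case/andP: (shuffle_mean01 (all_messages encoder r X' c) f01).
have V1 : view_mean encoder r X' f <= 1.
  by apply: unif_mean_le1 => // c; case/andP: (shuffle_mean01 (all_messages encoder r X' c) f01).
apply: (le_trans key).
have [de0 de1] := andP delta01.
have e0 : 0 < (inveps (eps P) (delta P))%:R :> R by rewrite ltr0n inveps_ge1.
case/orP: (invepsP (delta P) eps_gt0) => [h|h].
  apply: lerD; last lra.
  by rewrite ler_wpM2r // ler_expR -[leLHS]mul1r ler_pdivrMr // mulrC.
(* Capped case: x = 1/e <= delta/4 gives exp(x) <= 1 + 2x <= 1 + delta/2, and the excess is additive
   because the probability is at most 1. *)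
set x := _^-1.
have x1 : x <= delta P / 4.
  by rewrite /x -[leLHS]mul1r ler_pdivrMr //; lra.
have x0 : 0 < x by rewrite invr_gt0.
have xh : x <= 1 / 2 by lra.
have hx : expR x <= 1 + delta P / 2.
  apply: (le_trans (expR_le_quad xh)).
  have : x * x <= x * (1 / 2) by rewrite ler_pM2l.
  by rewrite expr2; lra.
have he : 1 <= expR (eps P) by rewrite -[leLHS]expR0 ler_expR ltW.
have : expR x * view_mean encoder r X' f <= (1 + delta P / 2) * view_mean encoder r X' f.
  by rewrite ler_wpM2r.
have : 1 * view_mean encoder r X' f <= expR (eps P) * view_mean encoder r X' f.
  by rewrite ler_wpM2r.
have : delta P / 2 * view_mean encoder r X' f <= delta P / 2 * 1.
  by rewrite ler_wpM2l //; lra.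
lra.
Qed.

End ProtocolPrivacy.

(** * Accuracy *)

Lemma l2norm_le (R : realType) (d : nat) (x : 'rV[R]_d) (A : R) : 0 <= A ->
  (forall j, `|x ord0 j| <= A) -> l2norm x <= Num.sqrt d%:R * A.
Proof.
move=> A0 hx; rewrite -[X in _ * X]ger0_norm // -sqrtr_sqr -sqrtrM // /l2norm.
rewrite ler_wsqrtr // mulr_natl -[X in _ *+ X]card_ord -sumr_const.
by apply: ler_sum => j _; rewrite -(real_normK (num_real (x ord0 j))) lerXn2r ?nnegrE.
Qed.

Lemma heads_tail (R : realType) (n T D M : nat) (j : 'I_D) (s : R) :
  (0 < M)%N -> (D * M <= T)%N -> 0 <= s <= 1 ->
  unif_mean (fun c : {ffun 'I_n -> T.-tuple bool} =>
    (s * (n * M)%:R < `|(heads M c j)%:R - (n * M)%:R / 2|)%R%:R)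
  <= 2 * expR (- (s ^+ 2 * (n * M)%:R / 2)).
Proof.
move=> M0 DMT s01.
pose A (h : nat) : R := (s * (n * M)%:R < `|h%:R - (n * M)%:R / 2|)%R%:R.
pose phi (i : 'I_D) (h : nat) : R := if i == j then A h else 1.
rewrite (eq_unif_mean (G := fun c => \prod_i phi i (heads M c i))); last first.
  by move=> c; rewrite (bigD1 j) //= /phi eqxx big1 ?mulr1 // => i /negPf ->.
rewrite (heads_independent n M0 DMT) (bigD1 j) //= [X in _ * X]big1 ?mulr1; last first.
  move=> i /negPf ij; rewrite -[RHS](binw_sum R (n * M)); apply: eq_bigr => h _.
  by rewrite /phi ij mulr1.
apply: le_trans (binw_tail (n * M) s01); rewrite [leRHS]big_mkcond /=.
apply: ler_sum => h _; rewrite /phi eqxx /A.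
by case: (_ < _)%R; rewrite ?mulr1 ?mulr0.
Qed.

Section ProtocolAccuracy.
Variables (R : realType) (P : params R).
Local Notation n := (nusers P).
Local Notation d := (vdim P).
Local Notation T := (Ptime P).
Local Notation g := (Pscale P).
Local Notation M := (Pcoins P).
Local Notation N := (n * M)%N.
Local Notation s := (margin n d (eps P) (delta P) (beta P)).

Hypothesis n_gt0 : (0 < n)%N.
Hypothesis d_gt0 : (0 < d)%N.
Hypothesis eps_gt0 : 0 < eps P.
Hypothesis delta01 : 0 < delta P < 1.
Hypothesis beta01 : 0 < beta P < 1.
Hypothesis big_n : 1 < eps P * n%:R.

Let delta_gt0 : 0 < delta P. Proof. by case/andP: delta01. Qed.
Let beta_gt0 : 0 < beta P. Proof. by case/andP: beta01. Qed.

Section Decoder.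
Variables (r c : T.-tuple bool) (y : 'I_(nbuckets P)) (ms : seq nat).
Hypothesis ms_size : (size ms <= Pmsgs P)%N.

Lemma exec_decoder : exists2 s',
  exec decoder (dec_init r c y ms) T s' &
  forall j, (j < d)%N -> rarr s' j = estimate R n g M (count_mem (Pbase P r y + j)%N ms).
Proof.
eexists.
  eapply exec_le.
    apply: exec_guard; first by rewrite /= -ltNge.
    apply: (@exec_setup R n d (nbuckets P) y (size ms) (eps P) (delta P) (beta P)) => //.
      exact: bucket_lt.
    eapply exec_seq; last exact: exec_skip.
    by apply: exec_estimate.
  have : (estimate_time d (size ms) <= estimate_time d (Pmsgs P))%N.
    by rewrite /estimate_time ltnS leq_mul2r leq_add2r leq_mul2l ms_size !orbT.
  by rewrite /Ptime; lia.
by move=> j jd; rewrite /= jd.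
Qed.

Lemma decoder_halts : halts_within T decoder (dec_init r c y ms).
Proof. by have [s' hs _] := exec_decoder; rewrite /halts_within (run_exec hs). Qed.

Lemma decoder_outputE (j : 'I_d) : dec_output T decoder r c y ms ord0 j =
  estimate R n g M (count_mem (Pbase P r y + j)%N ms).
Proof. by have [s' hs h] := exec_decoder; rewrite mxE (run_exec hs) //= h. Qed.

End Decoder.

Section Accuracy.
Variables (X : dataset P) (y : 'I_(nbuckets P)) (eta : R).
Hypothesis X_valid : valid_dataset X.
Hypothesis eta_gt : Num.sqrt d%:R * (1 + s * N%:R / g%:R) < eta.

Definition collides (r : T.-tuple bool) (i : 'I_n) : bool :=
  ((X i).1 != y) && (hash (Pybits P) r (X i).1 (Phbits P) == hash (Pybits P) r y (Phbits P)).

Definition noisy (r : T.-tuple bool) (c : {ffun 'I_n -> T.-tuple bool}) (j : 'I_d) : bool :=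
  s * N%:R < `|(heads M c (Pbase P r y + j))%:R - N%:R / 2|.

Definition estimates (r : T.-tuple bool) (c : {ffun 'I_n -> T.-tuple bool}) : 'rV[R]_d :=
  \row_j estimate R n g M (offset r X (Pbase P r y + j) + heads M c (Pbase P r y + j)).

Lemma cell_in (r : T.-tuple bool) (j : 'I_d) : (Pbase P r y + j < Pcells P)%N.
Proof. by apply: leq_trans (base_le P r y); rewrite ltn_add2l. Qed.

Lemma accuracy_probE : accuracy_prob T encoder decoder eta X y =
  unif_mean (fun r : T.-tuple bool => unif_mean (fun c : {ffun 'I_n -> T.-tuple bool} =>
    (l2norm (bucket_sum X y - estimates r c) < eta)%R%:R)).
Proof.
apply: eq_unif_mean => r; apply: eq_unif_mean => c.
apply: shuffle_mean_cst => ms pms.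
have cards : (0 < #|{: T.-tuple bool}|)%N.
  by apply/card_gt0P; exists [tuple false | _ < T].
rewrite -[RHS](unif_mean_cst _ cards); apply: eq_unif_mean => c'.
suff -> : dec_output T decoder r c' y ms = estimates r c by [].
apply/rowP => j; rewrite decoder_outputE; last first.
  by rewrite (perm_size pms); exact: size_messages.
rewrite mxE; congr estimate.
by rewrite (seq.permP pms) count_messages // cell_in.
Qed.

(** Distinct classes a and b own the disjoint intervals of length d starting at d a and d b. *)
Lemma cell_value_no_collision (r : T.-tuple bool) (i : 'I_n) (j : 'I_d) : ~~ collides r i ->
  cell_value (Pbase P r (X i).1) (row_cells (X i).2) (Pbase P r y + j) =
  if (X i).1 == y then (X i).2 ord0 j else 0.
Proof.
rewrite /collides /cell_value; case: eqVneq => [->|_] /=.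
  by rewrite leq_addr addKn row_cells_ord.
move=> hne; case: ifP => // le; apply: row_cells_out.
have jd := ltn_ord j; rewrite /Pbase in le *.
move: (hash _ _ _ _) (hash _ _ _ _) hne le => b a ab le.
have ba : (a < b)%N.
  rewrite ltn_neqAle ab /= leqNgt; apply/negP => lt.
  have : (d * b.+1 <= d * a)%N by rewrite leq_mul2l lt orbT.
  by rewrite mulnS; lia.
have : (d * a.+1 <= d * b)%N by rewrite leq_mul2l ba orbT.
by rewrite mulnS; lia.
Qed.

(** Per coordinate, rounding contributes at most n/g <= 1 and the noise at most sN/g; the square
    root of d comes from passing to the Euclidean norm. *)
Lemma accurate_run r c : (forall i, ~~ collides r i) -> (forall j, ~~ noisy r c j) ->
  l2norm (bucket_sum X y - estimates r c) < eta.
Proof.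
move=> nocoll quiet; apply: le_lt_trans eta_gt.
have g0 : 0 < g%:R :> R by rewrite ltr0n scale_ge1.
have s0 : 0 < s := margin_gt0 eps_gt0 delta01 beta01 n_gt0 d_gt0.
apply: l2norm_le => [|j].
  by rewrite addr_ge0 // divr_ge0 // mulr_ge0 // ltW.
set S := bucket_sum X y ord0 j.
have SE : S = \sum_(i < n) (if (X i).1 == y then (X i).2 ord0 j else 0).
  by rewrite /S /bucket_sum summxE big_mkcond.
pose v (i : 'I_n) : R := if (X i).1 == y then (X i).2 ord0 j else 0.
have bounds i : g%:R * (1 + v i) <= (cell_count (Pbase P r (X i).1) (row_cells (X i).2) g
    (Pbase P r y + j))%:R <= g%:R * (1 + v i) + 1.
  have h k : `|row_cells (X i).2 k| <= 1 by apply: row_cells_le1; exact: X_valid.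
  have := cell_count_bounds (Pbase P r (X i).1) g h (Pbase P r y + j).
  by rewrite cell_value_no_collision // => /andP[-> /ltW ->].
set o := (offset r X (Pbase P r y + j))%:R : R.
have sumv : \sum_(i < n) g%:R * (1 + v i) = g%:R * (n%:R + S).
  by rewrite -mulr_sumr big_split /= sumr_const card_ord SE.
have o1 : g%:R * (n%:R + S) <= o.
  by rewrite -sumv /o natr_sum; apply: ler_sum => i _; case/andP: (bounds i).
have o2 : o <= g%:R * (n%:R + S) + n%:R.
  rewrite -sumv /o natr_sum -[X in _ + X%:R]card_ord -sumr_const -big_split /=.
  by apply: ler_sum => i _; case/andP: (bounds i).
have := quiet j; rewrite /noisy -leNgt => q.
set h := (heads M c (Pbase P r y + j))%:R in q.
have -> : (bucket_sum X y - estimates r c) ord0 j =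
    - ((o - g%:R * (n%:R + S) + (h - N%:R / 2)) / g%:R).
  rewrite !mxE -/S /estimate natrD -/o -/h natrM.
  by field; rewrite gt_eqF.
rewrite normrN normrM normfV (gtr0_norm g0) ler_pdivrMr // mulrDl mul1r divfK ?gt_eqF //.
have ng : n%:R <= g%:R :> R by rewrite ler_nat /Pscale /scale leq_addr.
apply: le_trans (ler_normD _ _) _; apply: lerD => //.
by rewrite ler_norml; apply/andP; split; have := ler0n R n; lra.
Qed.

(** The mean number of collisions is at most n / 2^k; users of the queried bucket contribute
    nothing. *)
Lemma collision_mean : unif_mean (fun r => \sum_i (collides r i)%:R) <= beta P / 2.
Proof.
rewrite unif_mean_sum.
apply: (@le_trans _ _ (\sum_(i < n) (2 ^+ Phbits P)^-1)).
  apply: ler_sum => i _; rewrite /collides.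
  have [e|ne] := eqVneq (X i).1 y.
    by rewrite /unif_mean big1 ?mul0r ?invr_ge0 ?exprn_ge0.
  apply: hash_collision => //; try exact: bucket_lt.
  exact: hash_time.
rewrite sumr_const card_ord -[_ *+ n]mulr_natl ler_pdivrMr ?exprn_gt0 //.
have := dbl_stepsP (n + n)%:R beta_gt0; rewrite -/(hbits n (beta P)) -/(Phbits P) natrD; lra.
Qed.

(** Union bound over the d queried cells only. The tail estimate at sN/2 from the privacy argument
    is reused; it suffices since 64 d 2^(-l) <= beta. *)
Lemma noise_mean r : unif_mean (fun c => \sum_j (noisy r c j)%:R) <= beta P / 2.
Proof.
have s0 : 0 < s := margin_gt0 eps_gt0 delta01 beta01 n_gt0 d_gt0.
have s18 := margin_le eps_gt0 delta01 beta01 n_gt0 d_gt0.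
set tb := tail_bound d (delta P) (beta P).
rewrite unif_mean_sum; apply: (@le_trans _ _ (\sum_(j < d) tb)).
  apply: ler_sum => j _.
  apply: le_trans (tail_le eps_gt0 delta01 beta01 n_gt0 d_gt0).
  have s01 : 0 <= s <= 1 by apply/andP; split; lra.
  have := heads_tail n (Ordinal (cell_in r j)) (coins_gt0 n_gt0 d_gt0 eps_gt0 delta01 beta01)
    (coins_time P) s01.
  move=> /le_trans; apply.
  rewrite ler_pM2l // ler_expR.
  have : 0 <= s ^+ 2 * N%:R by rewrite mulr_ge0 // sqr_ge0.
  by rewrite expr_div_n; lra.
rewrite sumr_const card_ord -[_ *+ d]mulr_natl /tb /tail_bound.
set l := loglen d (delta P) (beta P); pose z : R := (2 ^+ l)^-1.
have p2 : 0 < 2 ^+ l :> R by rewrite exprn_gt0.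
have z0 : 0 < z by rewrite invr_gt0.
have [de0 de1] := andP delta01; have [be0 be1] := andP beta01.
have dz : 64 * (d%:R * z) <= beta P.
  have := pow_loglen d delta01 beta01; rewrite -(ler_pM2r z0) -/l.
  have -> : delta P * beta P * 2 ^+ l * z = delta P * beta P by rewrite /z mulfK // gt_eqF.
  have : delta P * beta P <= 1 * beta P by rewrite ler_pM2r // ltW.
  lra.
have d1 : 1 <= d%:R :> R by rewrite ler1n.
have zd : z <= d%:R * z by rewrite -[leLHS]mul1r ler_pM2r.
have z4 : z ^+ 4 <= 1 by rewrite exprn_ile1 //; lra.
rewrite -/z; have -> : d%:R * (2 * z ^+ 5) = 2 * (d%:R * z) * z ^+ 4 by ring.
apply: (@le_trans _ _ (2 * (d%:R * z) * 1)); last lra.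
by rewrite ler_wpM2l //; lra.
Qed.

Lemma accuracy_prob_ge : 1 - beta P <= accuracy_prob T encoder decoder eta X y.
Proof.
rewrite accuracy_probE.
have cards : (0 < #|{: T.-tuple bool}|)%N.
  by apply/card_gt0P; exists [tuple false | _ < T].
have cards' : (0 < #|{: {ffun 'I_n -> T.-tuple bool}}|)%N.
  by apply/card_gt0P; exists [ffun => [tuple false | _ < T]].
(* The union bound in the form of an inequality between indicators, ready to be averaged. *)
have pointwise r c : 1 - \sum_i (collides r i)%:R - \sum_j (noisy r c j)%:R <=
    (l2norm (bucket_sum X y - estimates r c) < eta)%R%:R :> R.
  have sc : 0 <= \sum_i (collides r i)%:R :> R by rewrite sumr_ge0.
  have sn : 0 <= \sum_j (noisy r c j)%:R :> R by rewrite sumr_ge0.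
  case: (boolP [exists i, collides r i]) => [/existsP[i hi]|/existsPn nc].
    have : 1 <= \sum_i (collides r i)%:R :> R.
      by rewrite (bigD1 i) //= hi lerDl sumr_ge0.
    by have := ler0n R (l2norm (bucket_sum X y - estimates r c) < eta)%R; lra.
  case: (boolP [exists j, noisy r c j]) => [/existsP[j hj]|/existsPn nn].
    have : 1 <= \sum_j (noisy r c j)%:R :> R.
      by rewrite (bigD1 j) //= hj lerDl sumr_ge0.
    by have := ler0n R (l2norm (bucket_sum X y - estimates r c) < eta)%R; lra.
  by rewrite accurate_run //= mulr1n; lra.
have perr r : 1 - \sum_i (collides r i)%:R - beta P / 2 <=
    unif_mean (fun c : {ffun 'I_n -> T.-tuple bool} =>
      (l2norm (bucket_sum X y - estimates r c) < eta)%R%:R).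
  apply: le_trans (le_unif_mean (pointwise r)).
  by rewrite unif_meanB unif_mean_cst // lerD2l lerN2 noise_mean.
apply: le_trans (le_unif_mean perr).
rewrite unif_meanB unif_meanB !unif_mean_cst //.
have := collision_mean; lra.
Qed.

End Accuracy.
End ProtocolAccuracy.

(** * Time and error bounds *)

Section Bounds.
Variables (R : realType) (E : R).

Lemma plog_ge1 (t : R) : 1 <= plog t.
Proof. by rewrite /plog lerDl le_max lexx. Qed.

Lemma ln_le_plog (t : R) : ln t <= plog t - 1.
Proof. by rewrite /plog addrAC subrr add0r le_max lexx orbT. Qed.

(** One doubling before the last the target was not reached, and exp(1/2) <= 2 turns powers of two
    into natural logarithms. *)
Lemma dbl_steps_le (x z c : R) : 0 < x -> 0 < z -> 0 <= c -> ln (z / x) <= c ->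
  (dbl_steps x z)%:R <= 1 + 2 * c.
Proof.
move=> x0 z0 c0 hc; case h : (dbl_steps x z) => [|i]; first by lra.
have /least_min : (i < dbl_steps x z)%N by rewrite h.
rewrite -ltNge mulrC -ltr_pdivlMr // => hi.
suff : i%:R / 2 <= c by rewrite -[i.+1%:R]natr1; lra.
apply: le_trans hc.
rewrite -[leLHS]expRK ler_ln ?posrE ?expR_gt0 ?divr_gt0 //; apply/ltW/(le_lt_trans _ hi).
rewrite expRM_natl lerXn2r ?nnegrE ?expR_ge0 //.
have h2 : 2^-1 <= 1 / 2 :> R by lra.
by have := expR_le_quad h2; rewrite expr2; lra.
Qed.

Definition tbase (P : params R) : R :=
  (nusers P)%:R * (vdim P)%:R / beta P + plog ((nbuckets P)%:R / (eps P * delta P)).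

Definition main_case (P : params R) : Prop :=
  admissible E P /\ 1 < eps P * (nusers P)%:R.

(** Closed under sums and products, so the time bound follows from the shape of [Ptime]. *)
Definition poly_bounded (f : params R -> nat) : Prop :=
  exists C q, 0 <= C /\ forall P, main_case P -> (f P)%:R <= C * tbase P ^+ q.

Section Admissible.
Variable P : params R.
Hypothesis hP : admissible E P.

Lemma adm_nat : [/\ 1 <= (nusers P)%:R :> R, 1 <= (vdim P)%:R :> R & 1 <= (nbuckets P)%:R :> R].
Proof. by rewrite !ler1n; case: hP => [[]]. Qed.

Lemma adm_real : [/\ 0 < eps P, eps P <= E, 0 < delta P, delta P < 1 & 0 < beta P] /\ beta P < 1.
Proof. by case: hP => _ [/andP[? ?] /andP[? ?] /andP[? ?]]. Qed.

Lemma le_prod_tbase : (nusers P)%:R * (vdim P)%:R / beta P <= tbase P - 1.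
Proof. by rewrite /tbase; have := plog_ge1 ((nbuckets P)%:R / (eps P * delta P)); lra. Qed.

Lemma prod_ge0 : 0 <= (nusers P)%:R * (vdim P)%:R / beta P.
Proof. by have [[_ _ _ _ b0] _] := adm_real; rewrite divr_ge0 ?mulr_ge0 // ltW. Qed.

Lemma tbase_ge1 : 1 <= tbase P.
Proof. by have := le_prod_tbase; have := prod_ge0; lra. Qed.

Lemma users_div_beta_le : (nusers P)%:R / beta P <= tbase P.
Proof.
have [n1 d1 _] := adm_nat; have [[_ _ _ _ b0] _] := adm_real.
apply: (@le_trans _ _ ((nusers P)%:R * (vdim P)%:R / beta P)); last first.
  by have := le_prod_tbase; lra.
by rewrite ler_pM2r ?invr_gt0 // ler_peMr // ler0n.
Qed.

Lemma dim_div_beta_le : (vdim P)%:R / beta P <= tbase P.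
Proof.
have [n1 d1 _] := adm_nat; have [[_ _ _ _ b0] _] := adm_real.
apply: (@le_trans _ _ ((nusers P)%:R * (vdim P)%:R / beta P)); last first.
  by have := le_prod_tbase; lra.
by rewrite ler_pM2r ?invr_gt0 // ler_peMl // ler0n.
Qed.

Lemma le_div_beta (k : nat) : k%:R <= k%:R / beta P.
Proof.
have [[_ _ _ _ b0] b1] := adm_real.
by rewrite ler_peMr // ?ler0n // invf_ge1 // ltW.
Qed.

(** The term E compensates for dividing by eps delta, which may exceed 1 but is at most E. *)
Lemma ln_buckets_le : ln (nbuckets P)%:R <= tbase P + E.
Proof.
have [_ _ y1] := adm_nat; have [[e0 eE d0 d1 b0] b1] := adm_real.
have ed0 : 0 < eps P * delta P by rewrite mulr_gt0.
have y0 : 0 < (nbuckets P)%:R :> R by lra.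
have -> : (nbuckets P)%:R = (nbuckets P)%:R / (eps P * delta P) * (eps P * delta P).
  by rewrite divfK // gt_eqF.
rewrite lnM ?posrE ?divr_gt0 //; apply: lerD.
  apply: (le_trans (ln_le_plog _)); rewrite /tbase.
  by have := prod_ge0; lra.
apply: le_trans (ltW (ln_sublinear ed0)) _; apply: le_trans eE.
by rewrite ler_piMr // ltW.
Qed.

Lemma ln_invdelta_le : ln (delta P)^-1 <= tbase P + E.
Proof.
have [_ _ y1] := adm_nat; have [[e0 eE d0 d1 b0] b1] := adm_real.
have y0 : 0 < (nbuckets P)%:R :> R by lra.
have ed0 : 0 < eps P * delta P by rewrite mulr_gt0.
have := ln_le_plog ((nbuckets P)%:R / (eps P * delta P)).
rewrite ln_div ?posrE // lnM ?posrE // lnV ?posrE //.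
have := ln_ge0 y1; have := ln_sublinear e0; have := prod_ge0.
by rewrite /tbase; lra.
Qed.

Lemma E_gt0 : 0 < E.
Proof. by have [[e0 eE _ _ _] _] := adm_real; apply: lt_le_trans eE. Qed.

Lemma ybits_le : (Pybits P)%:R <= (3 + 2 * E) * tbase P.
Proof.
have [_ _ y1] := adm_nat; have t1 := tbase_ge1; have E0 := E_gt0.
have Et : E * 1 <= E * tbase P by rewrite ler_pM2l.
apply: (@le_trans _ _ (1 + 2 * (tbase P + E))); last by lra.
apply: dbl_steps_le; [exact: ltr01 | by lra | by lra |].
by rewrite divr1; exact: ln_buckets_le.
Qed.

Lemma loglen_le : (loglen (vdim P) (delta P) (beta P))%:R <= (133 + 2 * E) * tbase P.
Proof.
have [_ d1 _] := adm_nat; have t1 := tbase_ge1; have E0 := E_gt0.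
have [[e0 eE de0 de1 b0] b1] := adm_real.
have Et : E * 1 <= E * tbase P by rewrite ler_pM2l.
apply: (@le_trans _ _ (1 + 2 * (64 + tbase P + (tbase P + E)))); last by lra.
have d0 : 0 < (vdim P)%:R :> R by lra.
have db0 : 0 < (vdim P)%:R / beta P by rewrite divr_gt0.
apply: dbl_steps_le; [by rewrite mulr_gt0 | by lra | by lra |].
have -> : 64 * (vdim P)%:R / (delta P * beta P) = 64 * ((vdim P)%:R / beta P) * (delta P)^-1.
  by field; rewrite !gt_eqF.
rewrite lnM ?posrE ?invr_gt0 ?mulr_gt0 ?invr_gt0 //; apply: lerD; last exact: ln_invdelta_le.
rewrite lnM ?posrE //; apply: lerD; first by apply/ltW/ln_sublinear.
by apply: le_trans (ltW (ln_sublinear db0)) dim_div_beta_le.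
Qed.

Lemma pow_hbits_le : (2 ^ Phbits P)%N%:R <= 4 * tbase P.
Proof.
have [[_ _ _ _ b0] b1] := adm_real; have t1 := tbase_ge1.
case h : (Phbits P) => [|i]; first by rewrite expn0; lra.
have /least_min : (i < Phbits P)%N by rewrite h.
rewrite -ltNge mulrC -ltr_pdivlMr // natrD natrX exprS.
have := users_div_beta_le; rewrite mulrDl; lra.
Qed.

Lemma loglen_plog :
  (loglen (vdim P) (delta P) (beta P))%:R <= 129 * plog ((vdim P)%:R / (delta P * beta P)).
Proof.
have [_ d1 _] := adm_nat; have [[e0 eE de0 de1 b0] b1] := adm_real.
have d0 : 0 < (vdim P)%:R :> R by lra.
have db0 : 0 < delta P * beta P by rewrite mulr_gt0.
set t := (vdim P)%:R / (delta P * beta P).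
have p1 := plog_ge1 t.
apply: (@le_trans _ _ (1 + 2 * (64 + (plog t - 1)))); last by lra.
apply: dbl_steps_le => //; [by lra | by lra |].
rewrite -mulrA lnM ?posrE ?divr_gt0 //; apply: lerD; first by apply/ltW/ln_sublinear.
exact: ln_le_plog.
Qed.

Lemma inveps_le : (inveps (eps P) (delta P))%:R <= (1 + E) / eps P.
Proof.
have [[e0 eE de0 de1 b0] b1] := adm_real.
have [h _] := inveps_pred (delta P) e0.
rewrite ler_pdivlMr //; move: h; rewrite mulrBl mul1r; lra.
Qed.

(** Minimality of M makes N exceed its target by at most n, so sN is at most 40 * 512 g e l^2 + sn
    with sn <= g. Dividing by g gives 40 * 512 e l^2 + 1, and the rounding accounts for the second
    unit in the constant. *)
Lemma error_le : 1 < eps P * (nusers P)%:R ->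
  1 + margin (nusers P) (vdim P) (eps P) (delta P) (beta P)
      * (nusers P * Pcoins P)%:R / (Pscale P)%:R
  <= (40 * 512 + 2) * ((1 + E) / eps P) * (129 * plog ((vdim P)%:R / (delta P * beta P))) ^+ 2.
Proof.
move=> big_n; have [n1 d1 _] := adm_nat; have [[e0 eE de0 de1 b0] b1] := adm_real.
have n0 : (0 < nusers P)%N by case: hP => [[]].
have d0 : (0 < vdim P)%N by case: hP => [[]].
have de01 : 0 < delta P < 1 by rewrite de0.
have be01 : 0 < beta P < 1 by rewrite b0.
set s := margin _ _ _ _ _; set g := Pscale P; set M := Pcoins P.
set l := loglen (vdim P) (delta P) (beta P); set e := inveps (eps P) (delta P).
have s0 : 0 < s := margin_gt0 e0 de01 be01 n0 d0.
have s18 : s <= 1 / 8 := margin_le e0 de01 be01 n0 d0.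
have sE : 512 * g%:R * (e%:R * l%:R) * s = 1 := marginE e0 de01 be01 n0 d0.
have g0 : 0 < g%:R :> R by rewrite ltr0n scale_ge1.
have ng : (nusers P)%:R <= g%:R :> R by rewrite ler_nat /g /Pscale /scale leq_addr.
have l1 : 1 <= l%:R :> R by rewrite ler1n; apply: leq_trans (loglen_ge7 de01 be01 d0).
have e1 : 1 <= e%:R :> R by rewrite ler1n inveps_ge1.
have M0 : (0 < M)%N := coins_gt0 n0 d0 e0 de01 be01.
have : (M.-1 < M)%N by rewrite prednK.
move=> /least_min; rewrite -ltNge -subn1 natrB // /coins_needed -/l -/e -/g => hM.
have hN : s * (nusers P * M)%:R <= 40 * l%:R * (512 * g%:R * (e%:R * l%:R)) + s * (nusers P)%:R.
  have : s * ((nusers P)%:R * (M%:R - 1)) <=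
      s * (40 * l%:R * (512 * g%:R * (e%:R * l%:R)) ^+ 2) by rewrite ler_pM2l // ltW.
  have -> : s * (40 * l%:R * (512 * g%:R * (e%:R * l%:R)) ^+ 2) =
      40 * l%:R * (512 * g%:R * (e%:R * l%:R)) * (512 * g%:R * (e%:R * l%:R) * s) by ring.
  by rewrite sE natrM; lra.
have sn : s * (nusers P)%:R <= g%:R.
  apply: le_trans ng; rewrite ler_piMl //; lra.
have el : 1 <= e%:R * l%:R ^+ 2 :> R by rewrite mulr_ege1 // exprn_ege1.
apply: (@le_trans _ _ ((40 * 512 + 2) * e%:R * l%:R ^+ 2)).
  have : s * (nusers P * M)%:R / g%:R <= 40 * 512 * (e%:R * l%:R ^+ 2) + 1.
    rewrite ler_pdivrMr //; apply: (le_trans hN).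
    have -> : 40 * l%:R * (512 * g%:R * (e%:R * l%:R)) =
        40 * 512 * (e%:R * l%:R ^+ 2) * g%:R :> R by ring.
    by rewrite [leRHS]mulrDl mul1r lerD2l.
  lra.
have k0 : 0 < 40 * 512 + 2 :> R by lra.
apply: ler_pM; [by rewrite mulr_ge0 // ltW | exact: sqr_ge0 | by rewrite ler_pM2l // inveps_le |].
rewrite lerXn2r ?nnegrE ?ler0n ?loglen_plog //.
by have := plog_ge1 ((vdim P)%:R / (delta P * beta P)); lra.
Qed.

End Admissible.

Lemma pb_bound f (C : R) q : 0 <= C ->
  (forall P, main_case P -> (f P)%:R <= C * tbase P ^+ q) -> poly_bounded f.
Proof. by move=> C0 h; exists C, q. Qed.

Lemma pb_le f h : (forall P, main_case P -> (f P <= h P)%N) -> poly_bounded h -> poly_bounded f.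
Proof.
move=> fh [C [q [C0 hC]]]; exists C, q; split=> // P hP.
by apply: le_trans (hC P hP); rewrite ler_nat fh.
Qed.

Lemma pb_cst k : poly_bounded (fun=> k).
Proof. by apply: (@pb_bound _ k%:R 0) => // P _; rewrite expr0 mulr1. Qed.

Lemma pb_mul f h : poly_bounded f -> poly_bounded h -> poly_bounded (fun P => f P * h P)%N.
Proof.
move=> [C [q [C0 hC]]] [C' [q' [C0' hC']]].
apply: (@pb_bound _ (C * C') (q + q')); first exact: mulr_ge0.
move=> P hP; rewrite natrM exprD mulrACA.
by apply: ler_pM; rewrite ?ler0n ?hC ?hC'.
Qed.

Lemma pb_add f h : poly_bounded f -> poly_bounded h -> poly_bounded (fun P => f P + h P)%N.
Proof.
move=> [C [q [C0 hC]]] [C' [q' [C0' hC']]].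
apply: (@pb_bound _ (C + C') (q + q')); first exact: addr_ge0.
move=> P hP; have t1 := tbase_ge1 hP.1.
rewrite natrD mulrDl; apply: lerD.
  by apply: le_trans (hC P hP) _; rewrite ler_wpM2l // ler_weXn2l // leq_addr.
by apply: le_trans (hC' P hP) _; rewrite ler_wpM2l // ler_weXn2l // leq_addl.
Qed.

Lemma pb_S f : poly_bounded f -> poly_bounded (fun P => (f P).+1).
Proof.
move=> hf; apply: (pb_le (h := fun P => f P + 1)%N); first by move=> P _; rewrite addn1.
by apply: pb_add => //; exact: pb_cst.
Qed.

Lemma pb_linear f (C : R) : 0 <= C ->
  (forall P, main_case P -> (f P)%:R <= C * tbase P) -> poly_bounded f.
Proof. by move=> C0 h; apply: (@pb_bound _ C 1) => // P hP; rewrite expr1 h. Qed.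

Lemma pb_users : poly_bounded (fun P => nusers P).
Proof.
apply: (@pb_linear _ 1) => // P [hP _]; rewrite mul1r.
exact: le_trans (le_div_beta hP _) (users_div_beta_le hP).
Qed.

Lemma pb_dim : poly_bounded (fun P => vdim P).
Proof.
apply: (@pb_linear _ 1) => // P [hP _]; rewrite mul1r.
exact: le_trans (le_div_beta hP _) (dim_div_beta_le hP).
Qed.

Hypothesis hE : 0 < E.

Lemma pb_ybits : poly_bounded (@Pybits R).
Proof.
apply: (@pb_linear _ (3 + 2 * E)); first by move: hE; lra.
by move=> P [hP _]; exact: ybits_le.
Qed.

Lemma pb_loglen : poly_bounded (fun P => loglen (vdim P) (delta P) (beta P)).
Proof.
apply: (@pb_linear _ (133 + 2 * E)); first by move: hE; lra.
by move=> P [hP _]; exact: loglen_le.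
Qed.

Lemma pb_pow_hbits : poly_bounded (fun P => 2 ^ Phbits P)%N.
Proof. by apply: (@pb_linear _ 4) => // P [hP _]; exact: pow_hbits_le. Qed.

Lemma pb_hbits : poly_bounded (@Phbits R).
Proof.
by apply: pb_le pb_pow_hbits => P _; rewrite ltnW // ltn_expl.
Qed.

(** Here eps n > 1 is essential: it bounds e by n + 1, whereas 1/eps alone is not polynomial in the
    allowed quantities. *)
Lemma pb_inveps : poly_bounded (fun P => inveps (eps P) (delta P)).
Proof.
apply: (pb_le (h := fun P => (nusers P).+1)); last by apply: pb_S; exact: pb_users.
move=> P [hP big_n]; apply: least_le; apply/orP; left.
have [[e0 _ _ _ _] _] := adm_real hP.
by rewrite mulrC -[(nusers P).+1%:R]natr1 mulrDr mulr1; lra.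
Qed.

Lemma pb_scale : poly_bounded (@Pscale R).
Proof. exact: pb_add pb_users pb_dim. Qed.

Lemma pb_coins : poly_bounded (@Pcoins R).
Proof.
pose l (P : params R) := loglen (vdim P) (delta P) (beta P).
pose e (P : params R) := inveps (eps P) (delta P).
apply: (pb_le (h := fun P => 40 * l P * ((512 * Pscale P * (e P * l P)) *
   (512 * Pscale P * (e P * l P))))%N).
  move=> P [hP _]; have [n1 _ _] := adm_nat hP.
  apply: least_le; rewrite /coins_needed expr2 -!natrM ler_nat.
  by rewrite leq_pmull // -(ler1n R).
repeat first [exact: pb_cst | exact: pb_scale | exact: pb_loglen | exact: pb_inveps | apply: pb_mul].
Qed.

Lemma pb_cells : poly_bounded (@Pcells R).
Proof. exact: pb_mul pb_dim pb_pow_hbits. Qed.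

Lemma pb_msgs : poly_bounded (@Pmsgs R).
Proof.
apply: pb_mul; first exact: pb_users.
apply: pb_mul; first exact: pb_cells.
apply: pb_add; last exact: pb_coins.
by apply: pb_mul; [exact: pb_cst | exact: pb_scale].
Qed.

Lemma pb_time : poly_bounded (@Ptime R).
Proof.
rewrite /Ptime /setup_time /cells_time /estimate_time.
repeat first [exact: pb_cst | exact: pb_scale | exact: pb_loglen | exact: pb_inveps
  | exact: pb_users | exact: pb_dim | exact: pb_ybits | exact: pb_hbits | exact: pb_coins
  | exact: pb_cells | exact: pb_msgs | apply: pb_S | apply: pb_mul | apply: pb_add].
Qed.

End Bounds.

(** * The regime eps n <= 1 *)

Section SmallCase.
Variables (R : realType) (P : params R).
Hypothesis small : eps P * (nusers P)%:R <= 1.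

Lemma run_guard_small c (s : state R) : rreg s 0 * (ireg s 0)%:R <= 1 ->
  run 2 (guard c) s = ([::], s).
Proof.
move=> h; apply: (@run_exec _ _ _ 2) => //; apply: exec_if.
by rewrite [beval _ _]h; exact: exec_skip.
Qed.

(** Expand the sum of all (a_i - a_k)^2, which is nonnegative. *)
Lemma sq_sum_le (n : nat) (a : 'I_n -> R) : (\sum_i a i) ^+ 2 <= n%:R * \sum_i a i ^+ 2.
Proof.
have h : 0 <= \sum_i \sum_k (a i - a k) ^+ 2.
  by apply: sumr_ge0 => i _; apply: sumr_ge0 => k _; exact: sqr_ge0.
suff e : \sum_i \sum_k (a i - a k) ^+ 2 =
    2 * (n%:R * \sum_i a i ^+ 2) - 2 * (\sum_i a i) ^+ 2 by move: h; rewrite e; lra.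
transitivity (\sum_i (n%:R * a i ^+ 2 - 2 * a i * \sum_k a k + \sum_k a k ^+ 2)).
  apply: eq_bigr => i _.
  rewrite [n%:R * _]mulr_natl -[X in _ *+ X]card_ord -sumr_const mulr_sumr -sumrB -big_split /=.
  by apply: eq_bigr => k _; ring.
rewrite big_split /= sumrB -mulr_sumr -mulr_suml -mulr_sumr sumr_const card_ord.
by rewrite -[_ *+ n]mulr_natl; ring.
Qed.

Lemma l2norm_bucket_sum (X : dataset P) y : valid_dataset X ->
  l2norm (bucket_sum X y) <= (nusers P)%:R.
Proof.
move=> vX; rewrite -[leRHS]ger0_norm // -sqrtr_sqr ler_wsqrtr //.
pose a (i : 'I_(nusers P)) (j : 'I_(vdim P)) := if (X i).1 == y then (X i).2 ord0 j else 0.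
apply: (@le_trans _ _ (\sum_(j < vdim P) (nusers P)%:R * \sum_i a i j ^+ 2)).
  apply: ler_sum => j _; rewrite /bucket_sum summxE big_mkcond /=.
  exact: sq_sum_le.
rewrite -mulr_sumr exchange_big /= expr2 ler_wpM2l //.
rewrite -[X in _ <= X%:R]card_ord -sumr_const; apply: ler_sum => i _.
have := sum_sq_le1 (vX i); rewrite /a; case: ((X i).1 == y) => // _.
by rewrite big1 ?ler01 // => j _; rewrite expr0n.
Qed.

Lemma small_messages r (X : dataset P) c : all_messages (T := 2) encoder r X c = [::].
Proof.
rewrite /all_messages; elim: (enum _) => //= i s ->.
by rewrite cats0 /enc_output run_guard_small.
Qed.

Lemma small_accurate (eta : R) (X : dataset P) y : (nusers P)%:R < eta ->
  valid_dataset X -> accuracy_prob 2 encoder decoder eta X y = 1.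
Proof.
move=> heta vX.
have cards : (0 < #|{: 2.-tuple bool}|)%N by rewrite card_tuple card_bool.
have cards' : (0 < #|{: {ffun 'I_(nusers P) -> 2.-tuple bool}}|)%N.
  by apply/card_gt0P; exists [ffun => [tuple false | _ < 2]].
rewrite -[RHS](unif_mean_cst 1 cards); apply: eq_unif_mean => r.
rewrite -[RHS](unif_mean_cst 1 cards'); apply: eq_unif_mean => c.
apply: shuffle_mean_cst => ms _.
rewrite -[RHS](unif_mean_cst 1 cards); apply: eq_unif_mean => c'.
have -> : dec_output 2 decoder r c' y ms = 0.
  by apply/rowP => j; rewrite !mxE run_guard_small.
by rewrite subr0 (le_lt_trans (l2norm_bucket_sum y vX)).
Qed.

Lemma small_private : 0 < eps P -> 0 < delta P -> shuffle_dp P 2 encoder.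
Proof.
move=> e0 d0 r X X' _ _ _ S.
set f := fun ms => (S ms)%:R.
have f01 ms : 0 <= f ms <= 1 by rewrite /f; case: (S ms); rewrite ?ler01 lexx.
have -> : view_mean encoder r X f = view_mean encoder r X' f.
  by apply: eq_unif_mean => c; rewrite !small_messages.
have V0 : 0 <= view_mean encoder r X' f.
  by apply: unif_mean_ge0 => c; case/andP: (shuffle_mean01 (all_messages encoder r X' c) f01).
have he : 1 <= expR (eps P) by rewrite -[leLHS]expR0 ler_expR ltW.
have : 1 * view_mean encoder r X' f <= expR (eps P) * view_mean encoder r X' f.
  by rewrite ler_wpM2r.
lra.
Qed.

End SmallCase.

Theorem theorem11 (R : realType) (E : R) (hE : 0 < E) :
  exists (enc dec : cmd) (C1 C2 : R) (q1 q2 : nat),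
  forall P : params R, admissible E P ->
  exists T : nat,
    [/\ T%:R <= time_bound C2 q2 P,
        encoder_time P T enc,
        decoder_time P T enc dec,
        shuffle_dp P T enc &
        accurate P T enc dec (error_bound C1 q1 P)].
Proof.
have [C [q [C0 hC]]] := pb_time hE.
pose K : R := (40 * 512 + 2) * (1 + E) * 129 ^+ 2.
have K0 : 0 < K by rewrite !mulr_gt0 ?exprn_gt0 //; lra.
(* K collects the constants of [error_le]; the added 1 makes the error bound strict, and the added 2
   covers the two steps of the guarded case. The exponent 2 is that of l in e l^2. *)
exists encoder, decoder, (K + 1), (C + 2), 2%N, q => P hP.
have [n1 d1 y1] := adm_nat hP; have [[e0 eE de0 de1 b0] b1] := adm_real hP.
have tq : 1 <= tbase P ^+ q by rewrite exprn_ege1 // (tbase_ge1 hP).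
pose Q : R := Num.sqrt (vdim P)%:R / eps P * plog ((vdim P)%:R / (delta P * beta P)) ^+ 2.
have sqd : 1 <= Num.sqrt (vdim P)%:R :> R by rewrite -[leLHS]sqrtr1 ler_wsqrtr.
have p1 : 1 <= plog ((vdim P)%:R / (delta P * beta P)) ^+ 2.
  by rewrite exprn_ege1 // plog_ge1.
have Q1 : 1 / eps P <= Q.
  by rewrite -[leLHS]mulr1; apply: ler_pM => //; rewrite ?divr_ge0 ?ler_pM2r ?invr_gt0 // ltW.
have Q0 : 0 < Q by apply: lt_le_trans Q1; rewrite divr_gt0.
have KQ : 0 < K * Q by rewrite mulr_gt0.
have errE : error_bound (K + 1) 2 P = K * Q + Q by rewrite /error_bound -/Q mulrDl mul1r.
have [small|big] := leP (eps P * (nusers P)%:R) 1.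
  (* One step for the test of the guard and one for the skip; no message is sent and the zero
     estimate errs by at most n <= 1/eps. *)
  exists 2%N; split.
  - apply: (@le_trans _ _ ((C + 2) * 1)); first by lra.
    by rewrite ler_wpM2l //; lra.
  - by move=> r c u _; rewrite /halts_within run_guard_small.
  - by move=> r e X c ms y _ _; rewrite /halts_within run_guard_small.
  - exact: small_private.
  - move=> X vX y; rewrite small_accurate //; first by lra.
    rewrite errE; apply: (@le_lt_trans _ _ (1 / eps P)); last by lra.
    by rewrite ler_pdivlMr // mulrC.
have n0 : (0 < nusers P)%N by rewrite -(ltr0n R); lra.
have d0 : (0 < vdim P)%N by rewrite -(ltr0n R); lra.
have de01 : 0 < delta P < 1 by rewrite de0.
have be01 : 0 < beta P < 1 by rewrite b0.
exists (Ptime P); split.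
- apply: le_trans (hC P (conj hP big)) _.
  by apply: ler_wpM2r; [lra | rewrite lerDl].
- by move=> r c u vu; exact: encoder_halts.
- move=> r e X c ms y vX pms; apply: decoder_halts => //.
  by rewrite (perm_size pms); exact: size_messages.
- exact: protocol_private.
- move=> X vX y; apply: accuracy_prob_ge => //.
  rewrite errE.
  apply: (@le_lt_trans _ _ (K * Q)); last by rewrite ltrDl.
  have -> : K * Q = Num.sqrt (vdim P)%:R * ((40 * 512 + 2) * ((1 + E) / eps P) *
      (129 * plog ((vdim P)%:R / (delta P * beta P))) ^+ 2).
    by rewrite /K /Q; field; rewrite gt_eqF.
  rewrite ler_wpM2l ?sqrtr_ge0 //; exact: error_le.
Qed.
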